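(* For every permutation class $\mathcal{C}$, one of the following occurs: (1) $|\mathcal{C}_n|\ge F_n$ for all $n\ge 1$; or (2) $\mathcal{C}$ lies in the grid class of a matching, and there is a polynomial $p(n)$ such that $|\mathcal{C}_n|=p(n)$ for all sufficiently large $n$.
   Context: Write $[n]=\{1,\dots,n\}$ and let $S_n$ be the set of permutations of $[n]$. A permutation $\pi\in S_n$ contains $\sigma\in S_k$ (written $\sigma\le\pi$) if $\pi$ has a subsequence of length $k$ in the same relative order as $\sigma$. A permutation class is a set $\mathcal{C}$ of permutations such that $\pi\in\mathcal{C}$ and $\sigma\le\pi$ imply $\sigma\in\mathcal{C}$. We write $\mathcal{C}_n=\mathcal{C}\cap S_n$. $F_n$ is the $n$th Fibonacci number, indexed so that $F_n$ is the number of ways to write $n$ as an ordered sum of $1$'s and $2$'s: $F_1=1$, $F_2=2$, $F_n=F_{n-1}+F_{n-2}$. For $\pi\in S_n$ and $A,B\subseteq[n]$, $\pi(A\times B)$ denotes the subsequence of $\pi$ consisting of the entries $\pi(i)$ with $i\in A$ and $\pi(i)\in B$. Empty and one-term sequences count as both increasing and decreasing. A $t\times u$ matrix $M$ means a matrix with entries in $\{0,1,-1\}$ having $t$ columns and $u$ rows, where $M_{k,\ell}$ is the entry in the $k$th column from the left and the $\ell$th row from the bottom. An $M$-gridding of $\pi\in S_n$ is a pair of integer sequences $1=c_1\le c_2\le\cdots\le c_{t+1}=n+1$ and $1=r_1\le r_2\le\cdots\le r_{u+1}=n+1$ such that for all $k\in[t]$, $\ell\in[u]$, the subsequence $\pi([c_k,c_{k+1})\times[r_\ell,r_{\ell+1}))$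 is increasing if $M_{k,\ell}=1$, decreasing if $M_{k,\ell}=-1$, and empty if $M_{k,\ell}=0$. (Here $[a,b)=\{a,a+1,\dots,b-1\}$.) The grid class $\operatorname{Grid}(M)$ is the set of all permutations that possess an $M$-gridding. For a $t\times u$ matrix $M$, $G(M)$ is the bipartite graph with vertices $x_1,\dots,x_t,y_1,\dots,y_u$ and edges $x_ky_\ell$ precisely when $M_{k,\ell}\ne 0$. A matching is a graph in which no two distinct edges share a vertex (every vertex has degree at most $1$). A class $\mathcal{C}$ lies in the grid class of a matching if $\mathcal{C}\subseteq\operatorname{Grid}(M)$ for some matrix $M$ such that $G(M)$ is a matching. *)

(* Defs.v *)
From HB Require Import structures.
From mathcomp Require Import all_boot all_order all_fingroup all_algebra.

Set Implicit Arguments.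
Unset Strict Implicit.
Unset Printing Implicit Defensive.

Local Open Scope nat_scope.

(* Permutations of [n] are elements of 'S_n, with positions and values shifted *)
(* to start from 0.                                                            *)

Definition contains (k n : nat) (s : 'S_k) (p : 'S_n) : Prop :=
  exists2 f : 'I_k -> 'I_n,
    forall i j : 'I_k, i < j -> f i < f j
    & forall i j : 'I_k, (p (f i) < p (f j)) = (s i < s j).

(* A set of permutations is given by its slices C n, so |C_n| is #|C n|. *)
Definition perm_class (C : forall n : nat, {set 'S_n}) : Prop :=
  forall (n k : nat) (p : 'S_n) (s : 'S_k),
    p \in C n -> contains s p -> s \in C k.

(* fib 0 = 1 counts the empty composition. *)
Fixpoint fib (n : nat) : nat :=
  match n with
  | 0 => 1
  | 1 => 1
  | (m.+1 as m').+1 => fib m' + fib m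
  end.

(* The first index of M : 'M[int]_(t, u) is the column counted from the left   *)
(* and the second one the row counted from the bottom: M has t columns and u   *)
(* rows in the geometric picture, the transpose of the usual matrix layout.    *)
Definition sign_matrix (t u : nat) (M : 'M[int]_(t, u)) : Prop :=
  forall (k : 'I_t) (l : 'I_u), M k l \in [:: 0; 1; -1]%R.

(* The positions of the entries of p([a, b) x [a', b')). *)
Definition cell (n : nat) (p : 'S_n) (a b a' b' : nat) : {set 'I_n} :=
  [set i : 'I_n | (a <= i < b) && (a' <= p i < b')].

Definition increasing_on (n : nat) (p : 'S_n) (A : {set 'I_n}) : Prop :=
  {in A &, forall i j : 'I_n, i < j -> p i < p j}.

Definition decreasing_on (n : nat) (p : 'S_n) (A : {set 'I_n}) : Prop :=
  {in A &, forall i j : 'I_n, i < j -> p j < p i}.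

(* d 0 <= ... <= d m cut {0, ..., n-1} into m possibly empty intervals, the    *)
(* k-th of which is [lo d k, hi d k).                                          *)
Definition divides_interval (n m : nat) (d : 'I_m.+1 -> nat) : Prop :=
  [/\ d ord0 = 0, d ord_max = n & forall i j : 'I_m.+1, i <= j -> d i <= d j].

Definition lo (m : nat) (d : 'I_m.+1 -> nat) (k : 'I_m) : nat :=
  d (widen_ord (leqnSn m) k).

Definition hi (m : nat) (d : 'I_m.+1 -> nat) (k : 'I_m) : nat :=
  d (lift ord0 k).

Definition is_gridding (t u n : nat) (M : 'M[int]_(t, u)) (p : 'S_n)
    (c : 'I_t.+1 -> nat) (r : 'I_u.+1 -> nat) : Prop :=
  [/\ divides_interval n c, divides_interval n r
    & forall (k : 'I_t) (l : 'I_u),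
        let A := cell p (lo c k) (hi c k) (lo r l) (hi r l) in
        [/\ M k l = 1%R -> increasing_on p A,
            M k l = (-1)%R -> decreasing_on p A
          & M k l = 0%R -> A = set0]].

Definition in_Grid (t u : nat) (M : 'M[int]_(t, u)) (n : nat) (p : 'S_n) : Prop :=
  exists (c : 'I_t.+1 -> nat) (r : 'I_u.+1 -> nat), is_gridding M p c r.

(* The vertices x_k are inl k and the vertices y_l are inr l. *)
Definition grid_graph (t u : nat) (M : 'M[int]_(t, u)) : rel ('I_t + 'I_u) :=
  fun v w => match v, w with
             | inl k, inr l => M k l != 0%R
             | inr l, inl k => M k l != 0%R
             | _, _ => false
             end.

Definition is_matching (V : finType) (e : rel V) : Prop :=
  forall v : V, #|[set w | e v w]| <= 1.

Definition in_grid_class_of_matching (C : forall n : nat, {set 'S_n}) : Prop :=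
  exists (t u : nat) (M : 'M[int]_(t, u)),
    [/\ sign_matrix M, is_matching (grid_graph M)
      & forall (n : nat) (p : 'S_n), p \in C n -> in_Grid M p].

Definition eventually_polynomial (a : nat -> nat) : Prop :=
  exists (p : {poly rat}) (N : nat),
    forall n : nat, N <= n -> ((a n)%:R = p.[n%:R])%R.

(* Main.v *)
Require Import Defs.
From mathcomp Require Import all_boot all_order all_fingroup all_algebra.
From mathcomp Require Import zify ring.
From Stdlib Require Import Classical.

(** Suppose that [#|C n0| < fib n0] for some [n0 >= 1]. A break of a permutation [f] is a position
[x] such that [f x] and [f (x + 1)] are not consecutive integers. Between two breaks [f] runs
through consecutive values in one direction, so that a permutation with [b] breaks is an inflation
of a permutation of length [b + 1] by monotone sequences. The theorem follows from a bound on the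
number of breaks of the members of [C].

Breaks are bounded ([few_breaks]). At a break, the values [f x] and [f (x + 1)] have a skipped value
strictly between them, taken at some other position. Given many breaks, Ramsey's theorem provides
[n0] of them for which all comparisons between two of these configurations come out the same way. If
the intervals of values spanned by the breaks overlap, their lower ends lie below their upper ends,
and both sequences are monotone: this is an alternation. If the intervals are disjoint, they
follow each other upwards or downwards; then either the breaks themselves, or one end of each break
together with the skipped value, form a sum of [n0] copies of 21, a skew sum of [n0] copies of 12,
or an alternation turned on its side, which is an alternation in the inverse permutation. A sum of
[n0] copies of 21 contains the sum of 1s and 21s attached to each composition of [n0] into ones and
twos, and an alternation of [2 * n0] points contains [2 ^ n0.-1] patterns of length [n0]; both
numbers are at least [fib n0], a contradiction. The inverse class has the same cardinals,
which settles the sideways alternations and bounds the breaks of inverses too.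

Gridding ([in_Grid_universal]). Cut the positions at the breaks of [f] and the values at the breaks
of its inverse: every run is alone in its column and in its row. One matching serves for all
permutations with fewer than [K] breaks: it has a column for each triple (rank of the run by
position, rank by value, direction), and a row for the same triple ordered by rank by value.

Counting ([eventually_polynomial_of_few_ends]). A permutation is determined by the relative order of
the boundedly many ends of its runs together with the numbers of interior points between successive
ends. Deleting an interior point preserves the relative order of the ends and decreases one of these
numbers. So, for each of the finitely many relative orders, the vectors that occur form a downset in
a power of the natural numbers, and the number of elements of weight [n] of such a downset is
eventually polynomial in [n] ([downset_hilbert]). *)

Set Implicit Arguments.
Unset Strict Implicit.
Unset Printing Implicit Defensive.
Import GRing.Theory Num.Theory.

(** * Permutations as functions on the natural numbers *)

(** Extending a permutation by the identity makes it a bijection of the natural numbers, so that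
neighbouring positions and consecutive values can be handled without bounds. *)
Definition pfun n (p : 'S_n) (x : nat) : nat :=
  if insub x is Some i then val (p i) else x.

Section PFun.
Variables (n : nat) (p : 'S_n).

Lemma pfun_ord (i : 'I_n) : pfun p i = p i.
Proof. by rewrite /pfun valK. Qed.

Lemma pfun_lt x : x < n -> pfun p x < n.
Proof. by move=> xn; rewrite -[x]/(val (Ordinal xn)) pfun_ord. Qed.

Lemma pfun_ge x : n <= x -> pfun p x = x.
Proof. by move=> nx; rewrite /pfun insubF // ltnNge nx. Qed.

Lemma pfun_inj : injective (pfun p).
Proof.
move=> x y.
case: (ltnP x n) (ltnP y n) => [xn|nx] [yn|ny].
- by rewrite -[x]/(val (Ordinal xn)) -[y]/(val (Ordinal yn)) !pfun_ord => /val_inj/perm_inj ->.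
- by rewrite (pfun_ge ny) => e; have := pfun_lt xn; rewrite e; lia.
- by rewrite (pfun_ge nx) => e; have := pfun_lt yn; rewrite -e; lia.
- by rewrite !pfun_ge.
Qed.

End PFun.

Lemma pfunK n (p : 'S_n) x : pfun p^-1%g (pfun p x) = x.
Proof.
case: (ltnP x n) => [xn|nx]; last by rewrite !pfun_ge.
by rewrite -[x]/(val (Ordinal xn)) !pfun_ord permK.
Qed.

Lemma pfunVK n (p : 'S_n) x : pfun p (pfun p^-1%g x) = x.
Proof. by rewrite -{1}[p]invgK pfunK. Qed.

Lemma eq_pfun n (p q : 'S_n) : pfun p =1 pfun q -> p = q.
Proof.
by move=> e; apply/permP=> i; apply: val_inj; have := e i; rewrite !pfun_ord.
Qed.

Lemma perm_of_fun n (f : nat -> nat) :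
  (forall x, x < n -> f x < n) ->
  (forall x y, x < n -> y < n -> f x = f y -> x = y) ->
  exists p : 'S_n, forall x, x < n -> pfun p x = f x.
Proof.
move=> fn finj; pose g (i : 'I_n) := Ordinal (fn i (ltn_ord i)).
have ginj : injective g.
  by move=> i j /(congr1 val) /= e; apply: val_inj; apply: finj e.
exists (perm ginj) => x xn.
by rewrite -[x]/(val (Ordinal xn)) pfun_ord permE.
Qed.

Lemma count_iota_lt n (a b : pred nat) z :
  z < n -> b z -> ~~ a z -> (forall x, x < n -> a x -> b x) ->
  count a (iota 0 n) < count b (iota 0 n).
Proof.
move=> zn bz az ab.
have zi : z \in iota 0 n by rewrite mem_iota.
rewrite -!(count_filter, size_filter).
have -> : [seq x <- iota 0 n | a x] = [seq x <- [seq x <- iota 0 n | b x] | a x].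
  rewrite -filter_predI; apply: eq_in_filter => x; rewrite mem_iota /= => xn.
  by case ax: (a x) => //=; rewrite ab.
rewrite size_filter -(count_predC a [seq x <- iota 0 n | b x]) -addn1 leq_add2l.
by rewrite -has_count; apply/hasP; exists z; rewrite ?mem_filter ?bz.
Qed.

(** The subsequence of [p] at the positions [h 0 < ... < h n.-1] is standardised by ranking its
values. *)
Lemma perm_class_pattern (C : forall n, {set 'S_n}) N (p : 'S_N) n (h : nat -> nat) :
  perm_class C -> p \in C N ->
  (forall x, x < n -> h x < N) ->
  (forall x y, x < y -> y < n -> h x < h y) ->
  exists2 s : 'S_n, s \in C n &
    forall x y, x < n -> y < n ->
      (pfun s x < pfun s y) = (pfun p (h x) < pfun p (h y)).
Proof.
move=> hC pC hN hinc; pose v x := pfun p (h x).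
pose r x := count (fun y => v y < v x) (iota 0 n).
have rlt x y : x < n -> y < n -> (r x < r y) = (v x < v y).
  move=> xn yn; case: (ltnP (v x) (v y)) => vxy.
    by apply: (@count_iota_lt _ _ _ x) => //=; [rewrite ltnn | move=> z _; lia].
  apply/negbTE; rewrite -leqNgt; apply: sub_count => z /=; lia.
have vinj x y : x < n -> y < n -> v x = v y -> x = y.
  move=> xn yn /pfun_inj e; case: (ltngtP x y) => // l.
    by have := hinc _ _ l yn; rewrite e ltnn.
  by have := hinc _ _ l xn; rewrite e ltnn.
have rinj x y : x < n -> y < n -> r x = r y -> x = y.
  move=> xn yn e; apply: vinj => //; have := rlt _ _ xn yn; have := rlt _ _ yn xn; lia.
have rn x : x < n -> r x < n.
  move=> xn; rewrite -[X in _ < X](size_iota 0 n) -count_predT.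
  by apply: (@count_iota_lt _ _ _ x) => //=; rewrite ltnn.
have [s sE] := perm_of_fun rn rinj.
exists s => [|x y xn yn]; last by rewrite !sE // rlt.
apply: hC pC _.
exists (fun i : 'I_n => Ordinal (hN i (ltn_ord i))) => i j; first by move=> ij; apply: hinc.
by rewrite -!pfun_ord /= !sE // rlt.
Qed.

(** The device for all lower bounds on [#|C n|]: the words in [ws] name subsequences of one
permutation, and it is enough to recover the word from the relative order of its subsequence. *)
Lemma count_patterns (C : forall n, {set 'S_n}) N (p : 'S_N) n
    (W : eqType) (ws : seq W) (h : W -> nat -> nat) :
  perm_class C -> p \in C N -> uniq ws ->
  (forall w x, w \in ws -> x < n -> h w x < N) ->
  (forall w x y, w \in ws -> x < y -> y < n -> h w x < h w y) ->
  (forall w w', w \in ws -> w' \in ws ->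
    (forall x y, x < n -> y < n -> (pfun p (h w x) < pfun p (h w y)) =
                                  (pfun p (h w' x) < pfun p (h w' y))) -> w = w') ->
  size ws <= #|C n|.
Proof.
move=> hC pC uws hN hinc hinj.
suff [ss [us sws sC]] : exists ss : seq 'S_n, [/\ uniq ss, size ss = size ws &
    forall s, s \in ss -> s \in C n /\ exists2 w, w \in ws &
       forall x y, x < n -> y < n ->
      (pfun s x < pfun s y) = (pfun p (h w x) < pfun p (h w y))].
  rewrite cardE -sws; apply: uniq_leq_size => // s /sC[]; by rewrite mem_enum.
elim: ws uws hN hinc hinj => [|w ws IH] /=; first by exists [::].
case/andP=> wws uws hN hinc hinj.
have [|||ss [us sws sC]] := IH uws.
- by move=> w' x w'ws; apply: hN; rewrite inE w'ws orbT.
- by move=> w' x y w'ws; apply: hinc; rewrite inE w'ws orbT.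
- by move=> w' w'' w'ws w''ws; apply: hinj; rewrite inE ?w'ws ?w''ws orbT.
have [s sCn sE] := perm_class_pattern hC pC (fun x => hN w x (mem_head w ws))
  (fun x y => hinc w x y (mem_head w ws)).
exists (s :: ss); split=> [|/=|s']; rewrite ?sws //=.
  rewrite us andbT; apply: contra wws => /sC[_ [w' w'ws s'E]].
  rewrite (hinj w w') ?mem_head ?inE ?w'ws ?orbT // => x y xn yn.
  by rewrite -sE // -s'E.
rewrite inE => /orP[/eqP->|/sC[s'C [w' w'ws s'E]]].
  by split=> //; exists w; rewrite ?mem_head.
by split=> //; exists w'; rewrite // inE w'ws orbT.
Qed.

(** Turning the plane over its diagonal exchanges the alternations with interleaved positions,
treated below, and those with interleaved values. *)
Definition inv_class (C : forall n, {set 'S_n}) n : {set 'S_n} :=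
  [set p | p^-1%g \in C n].

Lemma perm_class_inv (C : forall n, {set 'S_n}) : perm_class C -> perm_class (inv_class C).
Proof.
move=> hC n k p s; rewrite !inE => pC [f fi fE]; apply: hC pC _.
exists (fun j => p (f (s^-1%g j))) => i j; first by rewrite fE !permKV.
rewrite !permK.
have fm a b : (f a < f b) = (a < b).
  case: (ltngtP a b) => ab; first exact: fi.
    by have := fi _ _ ab; lia.
  by rewrite (val_inj ab) ltnn.
exact: fm.
Qed.

Lemma card_inv_class (C : forall n, {set 'S_n}) n : #|inv_class C n| = #|C n|.
Proof.
rewrite -[RHS](card_preimset _ (@invg_inj _)); apply: eq_card => p.
by rewrite !inE.
Qed.

(** * Structures that contain Fibonacci many patterns *)

(** For [b = true], a sum of [L] copies of 21 at the positions [x i < y i]; for [b = false], a skew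
sum of [L] copies of 12. One boolean covers both since all the comparisons are reversed together. *)
Definition has_pair_sum (b : bool) (L n : nat) (f : nat -> nat) : Prop :=
  exists x y : nat -> nat,
    [/\ forall i, i < L -> x i < y i < n,
        forall i j, i < j -> j < L -> y i < x j,
        forall i, i < L -> (f (y i) < f (x i)) = b /\ (f (x i) < f (y i)) = ~~ b
      & forall i j, i < j -> j < L -> (f (x i) < f (y j)) = b].

Definition monotone_along (L : nat) (u : nat -> nat) : Prop :=
  (forall i j, i < j -> j < L -> u i < u j) \/
  (forall i j, i < j -> j < L -> u j < u i).

(** The low points [x i] and the high points [y i] have interleaved positions. Their order is left
open inside a pair, from which the subsequences used below select a single point. *)
Definition has_alternation (L n : nat) (f : nat -> nat) : Prop :=
  exists x y : nat -> nat,
    [/\ forall i, i < L -> x i < n /\ y i < n,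
        forall i j, i < j -> j < L -> maxn (x i) (y i) < minn (x j) (y j),
        forall i j, i < L -> j < L -> f (x i) < f (y j),
        monotone_along L (f \o x) & monotone_along L (f \o y)].

(** Compositions of [m.+1] into ones and twos: [true] at [i] says that [i] and [i.+1] form a block.
*)
Fixpoint fib_words (m : nat) : seq bitseq :=
  match m with
  | 0 => [:: [::]]
  | 1 => [:: [:: false]; [:: true]]
  | (m1.+1 as m2).+1 =>
      [seq false :: w | w <- fib_words m2] ++ [seq true :: false :: w | w <- fib_words m1]
  end.

Lemma fib_words_ind (P : nat -> Prop) :
  P 0 -> P 1 -> (forall m, P m -> P m.+1 -> P m.+2) -> forall m, P m.
Proof.
move=> P0 P1 PS m; suff [] : P m /\ P m.+1 by [].
by elim: m => [|m [IH1 IH2]]; split=> //; apply: PS.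
Qed.

Lemma size_fib_words m : size (fib_words m) = fib m.+1.
Proof.
elim/fib_words_ind: m => // m IH1 IH2.
by rewrite [fib_words _]/= size_cat !size_map -/(fib_words m.+1) IH1 IH2.
Qed.

Lemma uniq_fib_words m : uniq (fib_words m).
Proof.
elim/fib_words_ind: m => // m IH1 IH2.
rewrite [fib_words _]/= -/(fib_words m.+1) cat_uniq !map_inj_uniq; try by move=> u v [].
rewrite IH1 IH2 andbT /=; apply/hasPn=> w /mapP[u _ ->].
by apply/mapP=> -[].
Qed.

Lemma fib_wordsP m w : w \in fib_words m ->
  size w = m /\ forall i, nth false w i -> ~~ nth false w i.+1.
Proof.
elim/fib_words_ind: m w => [w|w|m IH1 IH2 w]; first by rewrite inE => /eqP ->; split=> // -[].
  by rewrite !inE => /orP[]/eqP->; split=> // -[|[]].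
rewrite [fib_words _]/= -/(fib_words m.+1) mem_cat => /orP[]/mapP[u].
  by move=> /IH2[su nu] ->; rewrite /= su; split=> // -[|i] //= /nu.
by move=> /IH1[su nu] ->; rewrite /= su; split=> // -[|[|i]] //= /nu.
Qed.

(** Descents of a sum of 1s and 21s (ascents of a skew sum of 1s and 12s) mark where its blocks of
size 2 begin, so that they recover the composition. *)
Lemma fib_le_card_of_pair_sum (C : forall n, {set 'S_n}) N (p : 'S_N) b n :
  0 < n -> perm_class C -> p \in C N -> has_pair_sum b n N (pfun p) -> fib n <= #|C n|.
Proof.
move=> n0 hC pC [x [y [xy yx d inc]]].
rewrite -(prednK n0) -size_fib_words.
(* the second element of a block of size 2 is the upper position of the pair used by the first *)
pose h (w : bitseq) i := if (0 < i) && nth false w i.-1 then y i.-1 else x i.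
apply: (count_patterns (W := bitseq) (h := h) hC pC (uniq_fib_words _)).
- move=> w i _ ni; rewrite /h; case: ifP => _; first by have := xy i.-1; lia.
  by have := xy i; lia.
- move=> w i j _ ij nj; rewrite /h.
  have ? := xy i.-1; have ? := xy i; have ? := xy j.-1; have ? := xy j.
  case: ifP => [/andP[i0 _]|_]; case: ifP => [/andP[j0 _]|_].
  + by have := yx i.-1 j.-1; lia.
  + by have := yx i.-1 j; lia.
  + have [e|] := eqVneq i j.-1; first by rewrite e in ij *; lia.
    by have := yx i j.-1; lia.
  + by have := yx i j; lia.
move=> w w' /fib_wordsP[sw nw] /fib_wordsP[sw' nw'] e.
apply: (@eq_from_nth _ false); rewrite ?sw ?sw' // => i il.
have key u : size u = n.-1 -> (forall i, nth false u i -> ~~ nth false u i.+1) ->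
    (pfun p (h u i) < pfun p (h u i.+1)) = nth false u i (+) b.
  move=> su nu; rewrite /h /=.
  have di := d i; have di1 := d i.+1; have dip := d i.-1.
  have ii1 := inc i i.+1; have ipi1 := inc i.-1 i.+1.
  case: ifP => [/andP[i0 ui]|ui].
    have /negbTE -> : ~~ nth false u i by have := nu i.-1 ui; rewrite prednK.
    by case: b {d inc} di di1 dip ii1 ipi1; lia.
  case: (nth false u i); first by have [] := di ltac:(lia).
  by case: b {d inc} di di1 dip ii1 ipi1; lia.
have := e i i.+1; rewrite (key w) // (key w') // => /(_ ltac:(lia) ltac:(lia)).
exact: addIb.
Qed.

Lemma fibSS m : fib m.+2 = fib m.+1 + fib m.
Proof. by []. Qed.

Lemma fib_le_exp2 m : fib m.+1 <= 2 ^ m.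
Proof.
elim/fib_words_ind: m => // m IH1 IH2.
by rewrite fibSS; move: IH2; rewrite !expnS; lia.
Qed.

(** Choosing one of [x i], [y i] for each [i] gives [2 ^ n] subsequences. If one choice is fixed at
a point that is lowest among the high points or highest among the low points, then comparing with it
tells the high points from the low ones, and the remaining [2 ^ n.-1] patterns are distinct. Such a
point is at an end of the sequence because both sequences of values are monotone. *)
Lemma fib_le_card_of_alternation (C : forall n, {set 'S_n}) N (p : 'S_N) n :
  0 < n -> perm_class C -> p \in C N -> has_alternation n N (pfun p) -> fib n <= #|C n|.
Proof.
move=> n0 hC pC [x [y [xyN xy lohi mx my]]].
set m := n.-1.
have nE : n = m.+1 by rewrite prednK.
apply: (leq_trans (n := 2 ^ m)); first by rewrite nE fib_le_exp2.
have -> : 2 ^ m = size (enum {:m.-tuple bool}) by rewrite -cardE card_tuple card_bool.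
have main (e : bitseq -> nat -> bool) (g : nat -> nat) (z : nat) :
    z < n -> (forall k, k < m -> g k < n) ->
    (forall w k, k < m -> size w = m -> e w (g k) = nth false w k) ->
    (forall w k, k < m -> size w = m -> let h i := if e w i then y i else x i in
       (pfun p (h z) <= pfun p (h (g k))) = e w (g k)) ->
    size (enum {:m.-tuple bool}) <= #|C n|.
  move=> zn gn eg eh.
  apply: (count_patterns (h := fun (w : m.-tuple bool) i => if e w i then y i else x i)
    hC pC (enum_uniq _)).
  - by move=> w i _ /xyN; case: ifP; lia.
  - by move=> w i j _ ij jn; have := xy i j ij jn; do 2!case: ifP; lia.
  move=> w w' _ _ ww'; apply: val_inj; apply: (@eq_from_nth _ false) => [|k].
    by rewrite !size_tuple.
  rewrite size_tuple => km; rewrite -!eg ?size_tuple //.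
  have := eh w k km (size_tuple w); have := eh w' k km (size_tuple w') => /= <- <-.
  by have e' := ww' (g k) z (gn k km) zn; rewrite leqNgt e' -leqNgt.
case: my => [yinc|ydec].
  (* the first point is high, hence the lowest among the high ones *)
  apply: (main (fun w => nth true (true :: w)) S 0) => //= [k km|w k km sw|w k km sw].
  - by rewrite nE.
  - by apply: set_nth_default; rewrite sw.
  case: (nth true w k); first by have := yinc 0 k.+1 isT; rewrite /= nE ltnS => /(_ km); lia.
  by have := lohi k.+1 0; rewrite nE ltnS => /(_ km isT); lia.
case: mx => [xinc|xdec].
  (* the last point is high, hence the lowest among the high ones *)
  apply: (main (nth true) id m) => //= [|k km|w k km sw|w k km sw].
  - by rewrite nE.
  - by rewrite nE ltnW // ltnS.
  - by apply: set_nth_default; rewrite sw.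
  rewrite [nth true w m]nth_default ?sw //.
  case: (nth true w k); first by have := ydec k m km; rewrite /= nE ltnS leqnn => /(_ isT); lia.
  by have := lohi k m; rewrite nE => /(_ ltac:(lia) ltac:(lia)); lia.
(* the first point is low, hence the highest among the low ones *)
apply: (main (fun w => nth false (false :: w)) S 0) => //= [k km|w k km sw].
  by rewrite nE.
case: (nth false w k); first by have := lohi 0 k.+1 n0; rewrite nE ltnS => /(_ km); lia.
by have := xdec 0 k.+1 isT; rewrite /= nE ltnS => /(_ km); lia.
Qed.

(** * Ramsey's theorem *)

Section Ramsey.
Variables (T : finType) (t0 : T) (A : eqType) (c : A -> A -> T).

Fixpoint ramsey_bound (k : nat) : nat :=
  if k is k'.+1 then (#|T| * ramsey_bound k').+1 else 0.

Lemma sum_count_colour x (ys : seq A) :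
  \sum_(t : T) count (fun y => c x y == t) ys = size ys.
Proof.
elim: ys => [|y ys IH] /=; first by rewrite big1.
rewrite big_split /= IH (bigD1 (c x y)) //= eqxx big1 // => t.
by rewrite eq_sym => /negbTE ->.
Qed.

(** Asking for a different size [L t] for each colour lets the induction run on the total of the
sizes: the neighbours of the first element in a frequent colour [t] need one element less in colour
[t]. *)
Lemma ramsey_weighted k (L : T -> nat) (xs : seq A) :
  \sum_t L t <= k -> ramsey_bound k <= size xs ->
  exists t ys, [/\ subseq ys xs, size ys = L t & pairwise (fun x y => c x y == t) ys].
Proof.
elim: k L xs => [|k IH] L xs.
  rewrite leqn0 sum_nat_eq0 => /forallP/(_ t0)/eqP L0 _.
  by exists t0, [::]; rewrite sub0seq L0.
have [/existsP[t /eqP Lt0] _ _|/existsPn Lpos] := boolP [exists t, L t == 0].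
  by exists t, [::]; rewrite sub0seq Lt0.
case: xs => [|x xs] Lk //= sxs.
have [/existsP[t tP]|/existsPn no] :=
    boolP [exists t, ramsey_bound k <= count (fun y => c x y == t) xs]; last first.
  exfalso; move: sxs; rewrite ltnS -(sum_count_colour x xs) -sum_nat_const leqNgt => /negP; apply.
  rewrite (bigD1 t0) //= [X in _ < X](bigD1 t0) //= -addSn leq_add //.
    by rewrite ltnNge no.
  by apply: leq_sum => t _; rewrite ltnW // ltnNge no.
have [|| t' [ys [sub sy py]]] := IH (fun s => if s == t then (L s).-1 else L s)
    [seq y <- xs | c x y == t].
- move: Lk; rewrite (bigD1 t) //= [X in _ -> X <= _](bigD1 t) //= eqxx.
  have -> : \sum_(i | i != t) (if i == t then (L i).-1 else L i) = \sum_(i | i != t) L i.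
    by apply: eq_bigr => i /negbTE ->.
  by have := Lpos t; lia.
- by rewrite size_filter.
have sub' := subseq_trans sub (filter_subseq _ _).
have [e|ne] := eqVneq t' t; last first.
  exists t', ys; split=> //; last by rewrite sy (negbTE ne).
  exact: subseq_trans sub' (subseq_cons _ _).
rewrite {t'}e eqxx in sy py; exists t, (x :: ys); split; rewrite /= ?eqxx //.
  by rewrite sy prednK // lt0n Lpos.
rewrite py andbT; apply/allP=> y /(mem_subseq sub).
by rewrite mem_filter => /andP[].
Qed.
End Ramsey.

(** Reading the indices backwards. *)
Lemma alternation_of_decreasing L n f (x y : nat -> nat) :
  (forall i, i < L -> x i < n /\ y i < n) ->
  (forall i j, i < j -> j < L -> maxn (x j) (y j) < minn (x i) (y i)) ->
  (forall i j, i < L -> j < L -> f (x i) < f (y j)) ->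
  monotone_along L (f \o x) -> monotone_along L (f \o y) -> has_alternation L n f.
Proof.
move=> xyn xy lohi mx my; pose r i := L.-1 - i.
have mr u : monotone_along L u -> monotone_along L (u \o r).
  case=> um; [right|left] => i j ij jL /=; apply: um; rewrite /r; lia.
exists (x \o r), (y \o r); split=> /=.
- by move=> i iL; apply: xyn; rewrite /r; lia.
- by move=> i j ij jL; apply: xy; rewrite /r; lia.
- by move=> i j iL jL; apply: lohi; rewrite /r; lia.
- exact: mr mx.
- exact: mr my.
Qed.

(** * Permutations with many breaks *)

Section Homogeneous.
Variables (n : nat) (p : 'S_n) (L : nat) (x j : nat -> nat).
Notation f := (pfun p).
Notation g := (pfun p^-1).
Notation lo i := (minn (f (x i)) (f (x i).+1)).
Notation hi i := (maxn (f (x i)) (f (x i).+1)).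
Hypotheses (xn : forall i, i < L -> (x i).+1 < n) (jn : forall i, i < L -> j i < n)
  (xx : forall i i', i < i' -> i' < L -> (x i).+1 < x i')
  (jP : forall i, i < L -> lo i < f (j i) < hi i).

Definition homogeneous (r : nat -> nat -> bool) :=
  (forall i i', i < i' -> i' < L -> r i i') \/ (forall i i', i < i' -> i' < L -> ~~ r i i').

Let fi a b : f a = f b -> a = b. Proof. exact: pfun_inj. Qed.

(** Pairwise overlapping intervals have all their lower ends below all their upper ends. *)
Lemma overlapping_alternation asc :
  (forall i, i < L -> (f (x i) < f (x i).+1) = asc) ->
  homogeneous (fun i i' => lo i < lo i') -> homogeneous (fun i i' => hi i < hi i') ->
  (forall i i', i < i' -> i' < L -> lo i' <= hi i /\ lo i <= hi i') ->
  has_alternation L n f.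
Proof.
move=> ascE loM hiM over.
pose a i := if asc then x i else (x i).+1; pose b i := if asc then (x i).+1 else x i.
have faE i : i < L -> f (a i) = lo i.
  by move=> iL; have := ascE i iL; rewrite /a; case: asc {ascE a b}; lia.
have fbE i : i < L -> f (b i) = hi i.
  by move=> iL; have := ascE i iL; rewrite /b; case: asc {ascE a b faE}; lia.
have axb i : x i <= a i <= (x i).+1 /\ x i <= b i <= (x i).+1.
  by rewrite /a /b; case: asc {ascE a b faE fbE}; lia.
have ainj i i' : i < i' -> i' < L -> f (a i) <> f (a i').
  by move=> ii' i'L /fi; have := axb i; have := axb i'; have := xx ii' i'L; lia.
have binj i i' : i < i' -> i' < L -> f (b i) <> f (b i').
  by move=> ii' i'L /fi; have := axb i; have := axb i'; have := xx ii' i'L; lia.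
have abinj i i' : i < i' -> i' < L -> f (a i) <> f (b i') /\ f (a i') <> f (b i).
  by move=> ii' i'L; split=> /fi; have := axb i; have := axb i'; have := xx ii' i'L; lia.
exists a, b; split.
- by move=> i iL; have := axb i; have := xn iL; lia.
- by move=> i i' ii' i'L; have := axb i; have := axb i'; have := xx ii' i'L; lia.
- move=> i i' iL i'L; rewrite faE // fbE //; case: (ltngtP i i') => ii'.
  + by have := over _ _ ii' i'L; have := abinj _ _ ii' i'L; rewrite !faE // !fbE //; lia.
  + by have := over _ _ ii' iL; have := abinj _ _ ii' iL; rewrite !faE // !fbE //; lia.
  + by rewrite ii'; have := jP i'L; lia.
- case: loM => m; [left|right] => i i' ii' i'L /=; have := m i i' ii' i'L;
  have := ainj i i' ii' i'L; rewrite !faE //; lia.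
- case: hiM => m; [left|right] => i i' ii' i'L /=; have := m i i' ii' i'L;
  have := binj i i' ii' i'L; rewrite !fbE //; lia.
Qed.

(** Say that the intervals go upwards. If the breaks descend, they form a sum of 21s. If they
ascend, the skipped value forms a 21 with the end of the break that lies on its side: the lower end
if the skipped value is to the left, the upper end otherwise. These 21s either follow one another,
which gives a sum, or all left points precede all right points, with interleaved values. *)
Lemma disjoint_pair_sum_or_alternation b asc lft :
  (forall i, i < L -> (f (x i) < f (x i).+1) = asc) ->
  (forall i, i < L -> (j i < x i) = lft) ->
  (forall i i', i < i' -> i' < L -> if b then hi i < lo i' else hi i' < lo i) ->
  homogeneous (fun i i' => j i < x i') -> homogeneous (fun i i' => j i' < x i) ->
  homogeneous (fun i i' => j i < j i') ->
  has_pair_sum b L n f \/ has_alternation L n g.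
Proof.
move=> ascE lftE dis jx xj jj.
have jne i i' : i < L -> i' < L -> j i <> x i' /\ j i <> (x i').+1.
  move=> iL i'L.
  have {}dis : if b then [\/ i = i', hi i < lo i' | hi i' < lo i] else
          [\/ i = i', hi i < lo i' | hi i' < lo i].
    case: (ltngtP i i') => ii'; last by rewrite ii'; case: b {dis}; constructor.
      by have := dis _ _ ii' i'L; case: (b) => ?; [constructor 2|constructor 3].
    by have := dis _ _ ii' iL; case: (b) => ?; [constructor 3|constructor 2].
  have {}dis : [\/ i = i', hi i < lo i' | hi i' < lo i] by case: b dis.
  by have := jP iL; have := jP i'L; split=> /(congr1 f) e; case: dis => d; subst; lia.
have [ab|] := eqVneq asc (~~ b).
  left; exists x, (fun i => (x i).+1); split.
  - by move=> i iL; have := xn iL; lia.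
  - by move=> i i' ii' i'L; have := xx ii' i'L; lia.
  - by move=> i iL; have := ascE i iL; have := jP iL; rewrite ab; case: (b); lia.
  - by move=> i i' ii' i'L; have := dis _ _ ii' i'L; case: (b); lia.
move=> ab; have {ab}ab : asc = b by case: asc b ab {ascE dis} => [] [].
rewrite {asc}ab in ascE.
(* a i is the end of the break that forms a descent (b true) or an ascent (b false) with j i *)
pose a i := if lft then x i else (x i).+1.
have ajE i : i < L ->
    [/\ a i < n, (j i < a i) = lft, j i <> a i & (f (a i) < f (j i)) = (b == lft)].
  move=> iL; have := jne i i iL iL; have := ascE i iL; have := lftE i iL; have := jP iL.
  have := xn iL.
  by rewrite /a; case: lft {lftE a}; case: b {dis ascE} => /= *; split; lia.
have fa i : i < L -> lo i <= f (a i) <= hi i by move=> iL; rewrite /a; case: lft {ajE lftE a}; lia.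
pose alt := if lft then fun i i' => j i' < x i else fun i i' => x i' < j i.
have [S|S] : homogeneous alt.
- by rewrite /alt; case: lft {ajE a fa lftE alt} => //; case: jx => h; [right|left] => i i' ii' i'L;
  have := h i i' ii' i'L; have := jne i i' ltac:(lia) i'L; lia.
- (* left and right points interleave in value *)
  right; have am : monotone_along L a.
    by left=> i i' ii' i'L; have := xx ii' i'L; rewrite /a; case: (lft); lia.
  have jm : monotone_along L j.
    case: jj => h; [left|right] => i i' ii' i'L; have := h i i' ii' i'L => //.
    have : j i <> j i'; last by lia.
    have iL : i < L by lia.
    move=> /(congr1 f); have := jP iL; have := jP i'L.
    by have := dis _ _ ii' i'L; case: (b); lia.
  have aj i i' : i < L -> i' < L -> if lft then j i < a i' else a i < j i'.
    move=> iL i'L; have := ajE _ iL; have := ajE _ i'L; have := lftE _ iL; have := lftE _ i'L.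
    case: (ltngtP i i') => ii'; last first.
    + by rewrite ii'; case: (lft) => + + [] //; lia.
    + have := S _ _ ii' iL; have := xx ii' iL; have := jne _ _ i'L iL; rewrite /alt /a.
      by case: (lft); lia.
    + by have := xx ii' i'L; rewrite /a; case: (lft); lia.
  pose u i := f (if lft then j i else a i); pose v i := f (if lft then a i else j i).
  have uv i : i < L -> [/\ lo i <= u i <= hi i, lo i <= v i <= hi i, u i < n & v i < n].
    move=> iL; have := fa i iL; have := jP iL; have [an _ _ _] := ajE _ iL.
    by rewrite /u /v; case: (lft) => *; split; rewrite ?pfun_lt ?jn //; lia.
  have uv1 i : i < L -> u i < n /\ v i < n by move=> /uv[].
  have uvm i i' : i < L -> i' < L -> g (u i) < g (v i').
    by move=> iL i'L; rewrite /u /v !pfunK; have := aj i i' iL i'L; case: (lft).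
  have um : monotone_along L (g \o u).
    case: (if lft as l return monotone_along L (if l then j else a) then jm else am) => h;
    [left|right] => i i' ii' i'L; have := h i i' ii' i'L; rewrite /= /u !pfunK; case: (lft) => //.
  have vm : monotone_along L (g \o v).
    case: (if lft as l return monotone_along L (if l then a else j) then am else jm) => h;
    [left|right] => i i' ii' i'L; have := h i i' ii' i'L; rewrite /= /v !pfunK; case: (lft) => //.
  have [b1|b1] := boolP b.
    exists u, v; split=> // i i' ii' i'L; have := dis _ _ ii' i'L; rewrite b1.
    by have [? ? _ _] := uv i' i'L; have [? ? _ _] := uv i ltac:(lia); lia.
  apply: alternation_of_decreasing uvm um vm => // i i' ii' i'L; have := dis _ _ ii' i'L.
  by rewrite (negbTE b1); have [? ? _ _] := uv i' i'L; have [? ? _ _] := uv i ltac:(lia); lia.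
- left.
  exists (fun i => if lft then j i else a i), (fun i => if lft then a i else j i).
  have fj i : i < L -> lo i < f (j i) < hi i by apply: jP.
  split.
  + move=> i iL; have := ajE i iL; have := jn iL.
    by case: (lft) => ? []; lia.
  + move=> i i' ii' i'L; have := S _ _ ii' i'L; have := jne i i' ltac:(lia) i'L.
    have := jne i' i i'L ltac:(lia).
    by rewrite /alt /a; case: (lft); lia.
  + move=> i iL; have [_ _ ne e] := ajE i iL.
    have : f (a i) <> f (j i) by move/fi/esym.
    by move: e; case: (lft); case: (b); lia.
  + move=> i i' ii' i'L; have := dis _ _ ii' i'L.
    have := fj i ltac:(lia); have := fj i' i'L; have := fa i ltac:(lia); have := fa i' i'L.
    by case: (lft); case: (b); lia.
Qed.
End Homogeneous.

(** The range of [x] is left to [breaks]: thanks to the extension by the identity, runs make sense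
on all natural numbers. *)
Definition is_break (f : nat -> nat) (x : nat) : bool :=
  (f x != (f x.+1).+1) && (f x.+1 != (f x).+1).

Definition breaks (f : nat -> nat) (n : nat) : seq nat :=
  [seq x <- iota 0 n.-1 | is_break f x].

(** The outcomes of all the comparisons used to classify a pair of breaks. *)
Definition colour : finType :=
  (bool * bool * (bool * bool) * (bool * bool) * (bool * bool * bool))%type.

(** Ramsey's theorem for the comparisons between two breaks, with one break to spare, since a
property of a single break is read off from a pair that it starts. *)
Lemma many_breaks_structure L : exists K, forall n (p : 'S_n), K <= size (breaks (pfun p) n) ->
  [\/ exists b, has_pair_sum b L n (pfun p), has_alternation L n (pfun p) |
      has_alternation L n (pfun p^-1)].
Proof.
have [R RE] : exists R, R = ramsey_bound colour (\sum_(t : colour) L.+1) by eexists.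
exists R.*2 => n p; set f := pfun p; set bs := breaks f n => Kbs.
have fi a b : f a = f b -> a = b by apply: pfun_inj.
(* every other break, so that the pairs x, x + 1 are disjoint *)
pose x i := nth 0 bs i.*2.
have bsb i : i < size bs -> (nth 0 bs i).+1 < n /\ is_break f (nth 0 bs i).
  by move=> /(mem_nth 0); rewrite mem_filter mem_iota add0n /= => /andP[-> ?]; split=> //; lia.
have bs_sorted : sorted ltn bs by apply: sorted_filter (iota_ltn_sorted _ _); apply: ltn_trans.
have bs_lt i i' : i < i' -> i' < size bs -> nth 0 bs i < nth 0 bs i'.
  move=> ii' i's.
  by apply: (sorted_ltn_nth ltn_trans 0 bs_sorted) => //; rewrite inE //; lia.
pose lo i := minn (f (x i)) (f (x i).+1); pose hi i := maxn (f (x i)) (f (x i).+1).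
pose j i := pfun p^-1 (lo i).+1.
have xR i : i < R -> [/\ (x i).+1 < n, j i < n & lo i < f (j i) < hi i].
  move=> iR; have [xn xb] := bsb i.*2 ltac:(lia); split=> //.
    have fx : f (x i).+1 < n := pfun_lt p xn; have fx' : f (x i) < n := pfun_lt p (ltnW xn).
    by apply: pfun_lt; move: xb; rewrite /is_break /lo -/(x i); have := @fi (x i) (x i).+1; lia.
  rewrite /f /j pfunVK -/f.
  by move: xb; rewrite /is_break /lo /hi -/(x i); have := @fi (x i) (x i).+1; lia.
have xx i i' : i < i' -> i' < R -> (x i).+1 < x i'.
  move=> ii' i'R; have := bs_lt i.*2 i.*2.+1; have := bs_lt i.*2.+1 i'.*2.
  by rewrite /x; lia.
pose c i i' : colour := ((f (x i) < f (x i).+1, j i < x i, (hi i < lo i', hi i' < lo i),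
   (lo i < lo i', hi i < hi i'), (j i < x i', j i' < x i, j i < j i'))).
have [|t [ys [sub sy py]]] :=
  @ramsey_weighted colour (c 0 0) nat c _ (fun=> L.+1) (iota 0 R) (leqnn _).
  by rewrite size_iota RE.
pose h i := nth 0 ys i.
have hR i : i < L.+1 -> h i < R.
  by rewrite -sy => /(mem_nth 0)/(mem_subseq sub); rewrite mem_iota.
have ys_sorted : sorted ltn ys.
  by apply: subseq_sorted sub (iota_ltn_sorted _ _) => ? ? ?; apply: ltn_trans.
have h_lt i i' : i < i' -> i' < L.+1 -> h i < h i'.
  rewrite -sy => ii' i's.
  by apply: (sorted_ltn_nth ltn_trans 0 ys_sorted) => //; rewrite inE //; apply: ltn_trans i's.
have hc i i' : i < i' -> i' < L.+1 -> c (h i) (h i') = t.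
  rewrite -sy => ii' i's; apply/eqP.
  by move/(pairwiseP 0): py; apply; rewrite // inE //; apply: ltn_trans i's.
case: t {sy py} hc => [[[[asc lft] [c1 c2]] [c3 c4]] [[c5 c6] c7]] hc.
have hom (r : nat -> nat -> bool) b : (forall i i', i < i' -> i' < L.+1 -> r i i' = b) ->
    homogeneous L r.
  by case: b => rb; [left|right] => i i' ii' i'L; rewrite rb //; lia.
have ascE i : i < L -> (f (x (h i)) < f (x (h i)).+1) = asc.
  by move=> iL; have := hc i i.+1 ltac:(lia) ltac:(lia) => -[].
have lftE i : i < L -> (j (h i) < x (h i)) = lft.
  by move=> iL; have := hc i i.+1 ltac:(lia) ltac:(lia) => -[].
have xn' i : i < L -> (x (h i)).+1 < n by move=> iL; have [] := xR (h i) (hR i ltac:(lia)).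
have jn' i : i < L -> j (h i) < n by move=> iL; have [] := xR (h i) (hR i ltac:(lia)).
have jP' i : i < L -> lo (h i) < f (j (h i)) < hi (h i).
  by move=> iL; have [] := xR (h i) (hR i ltac:(lia)).
have xx' i i' : i < i' -> i' < L -> (x (h i)).+1 < x (h i').
  by move=> ii' i'L; apply: xx; [apply: h_lt => //; lia | apply: hR; lia].
have dsum b : (if b then c1 else c2) ->
    (exists b, has_pair_sum b L n f) \/ has_alternation L n (pfun p^-1).
  move=> bc; have [||||S|S] := @disjoint_pair_sum_or_alternation n p L (x \o h) (j \o h)
    xn' jn' xx' jP' b asc lft ascE lftE.
  - move=> i i' ii' i'L; have := hc i i' ii' ltac:(lia) => -[_ _ e1 e2 _ _ _ _ _].
    by move: bc; rewrite -e1 -e2; case: (b).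
  - by apply: (hom _ c5) => i i' ii' i'L; have := hc i i' ii' i'L => -[].
  - by apply: (hom _ c6) => i i' ii' i'L; have := hc i i' ii' i'L => -[].
  - by apply: (hom _ c7) => i i' ii' i'L; have := hc i i' ii' i'L => -[].
  - by left; exists b.
  - by right.
have [c1t|c1f] := boolP c1; first by case: (dsum true c1t) => ?; [constructor 1 | constructor 3].
have [c2t|c2f] := boolP c2; first by case: (dsum false c2t) => ?; [constructor 1 | constructor 3].
constructor 2; apply: (overlapping_alternation (x := x \o h) (j := j \o h) xn' xx' jP' ascE).
- by apply: (hom _ c3) => i i' ii' i'L; have := hc i i' ii' i'L => -[].
- by apply: (hom _ c4) => i i' ii' i'L; have := hc i i' ii' i'L => -[].
move=> i i' ii' i'L; have := hc i i' ii' ltac:(lia) => -[_ _ e1 e2 _ _ _ _ _].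
by move: c1f c2f; rewrite -e1 -e2 -!leqNgt.
Qed.

(** Any of the three structures in a member of [C] would provide [fib n0] patterns of length [n0],
in [C] or in its inverse class, which satisfies the same hypotheses. *)
Lemma few_breaks (C : forall n, {set 'S_n}) n0 :
  0 < n0 -> perm_class C -> #|C n0| < fib n0 ->
  exists K, forall n (p : 'S_n), p \in C n ->
    size (breaks (pfun p) n) < K /\ size (breaks (pfun p^-1) n) < K.
Proof.
move=> n00 hC few; have [K KP] := many_breaks_structure n0; exists K.
have main (D : forall n, {set 'S_n}) n (p : 'S_n) :
    perm_class D -> #|D n0| < fib n0 -> p \in D n -> size (breaks (pfun p) n) < K.
  move=> hD fewD pD; rewrite ltnNge; apply/negP => /KP[[b S]|S|S].
  - by have := fib_le_card_of_pair_sum n00 hD pD S; lia.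
  - by have := fib_le_card_of_alternation n00 hD pD S; lia.
  have pD' : p^-1%g \in inv_class D n by rewrite inE invgK.
  have := fib_le_card_of_alternation n00 (perm_class_inv hD) pD' S.
  by rewrite card_inv_class; lia.
move=> n p pC; split; first exact: main pC.
by apply: (main (inv_class C)); rewrite ?card_inv_class ?inE ?invgK //; apply: perm_class_inv.
Qed.

(** * Gridding along the runs *)

Section Cuts.
Variables (n : nat) (h : nat -> nat).
Hypothesis h_mono : forall i j, i <= j -> j < n -> h i <= h j.

(** The cut points of a partition into intervals on which the monotone function [h] is constant. *)
Definition cut (x : nat) : nat := count (fun i => h i < x) (iota 0 n).

Lemma cut_le x i : i < n -> (cut x <= i) = (x <= h i).
Proof.
move=> iN; rewrite /cut; case: (leqP x (h i)) => [xh|hx].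
  rewrite -(subnKC (ltnW iN)) iotaD count_cat [X in _ + X](_ : _ = 0).
    by rewrite addn0 (leq_trans (count_size _ _)) ?size_iota.
  apply/eqP; rewrite -leqn0 leqNgt -has_count; apply/hasPn=> j; rewrite mem_iota -leqNgt => jP.
  by apply: leq_trans xh (h_mono _ _); lia.
apply/negbTE; rewrite -ltnNge -(subnKC iN) iotaD count_cat.
rewrite (leq_trans _ (leq_addr _ _)) //.
have /eqP -> : count (fun i => h i < x) (iota 0 i.+1) == i.+1; last by [].
rewrite -[X in _ == X](size_iota 0 i.+1) -all_count; apply/allP=> j; rewrite mem_iota => jP.
by apply: leq_ltn_trans hx; apply: h_mono; lia.
Qed.

Lemma cut_interval x i : i < n -> (cut x <= i < cut x.+1) = (h i == x).
Proof. by move=> iN; rewrite ltnNge !cut_le //; lia. Qed.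

Lemma divides_interval_cut m : (forall i, i < n -> h i < m) ->
  divides_interval n (fun k : 'I_m.+1 => cut k).
Proof.
move=> hm; split=> [||i j ij] /=; first by rewrite /cut count_pred0.
  apply/eqP; rewrite -[X in _ == X](size_iota 0 n) -all_count.
  by apply/allP=> j; rewrite mem_iota => jn; apply: hm; lia.
by apply: sub_count => k /= /leq_trans; apply.
Qed.
End Cuts.

Section Runs.
Variables (n : nat) (p : 'S_n).
Notation f := (pfun p).
Notation g := (pfun p^-1).

Definition run (u : nat -> nat) (x : nat) : nat := count (is_break u) (iota 0 x).

Lemma runS u x : run u x.+1 = run u x + is_break u x.
Proof. by rewrite /run -addn1 iotaD count_cat /= addn0. Qed.

Lemma run_mono u x y : x <= y -> run u x <= run u y.
Proof. by move/subnKC=> <-; rewrite /run iotaD count_cat leq_addr. Qed.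

Lemma run_le_breaks u x : x < n -> run u x <= size (breaks u n).
Proof.
move=> xn; rewrite size_filter -(@subnKC x n.-1); last by lia.
by rewrite iotaD count_cat leq_addr.
Qed.

(** Whatever does not change across a position that is not a break is constant on the runs. *)
Lemma run_const (A : Type) (u : nat -> nat) (h : nat -> A) x y :
  (forall z, ~~ is_break u z -> h z = h z.+1) -> x <= y -> run u x = run u y -> h x = h y.
Proof.
move=> hb /subnKC <-; elim: (y - x) => [|d IH]; first by rewrite addn0.
rewrite addnS runS => e; have := run_mono u (leq_addr d x) => le.
have nb : ~~ is_break u (x + d) by lia.
by rewrite -(hb _ nb); apply: IH; lia.
Qed.

(** Neighbouring points with consecutive values are again such a pair for the inverse permutation.
*)
Lemma is_break_inv x : ~~ is_break f x ->
  ~~ is_break g (minn (f x) (f x.+1)) /\ maxn (f x) (f x.+1) = (minn (f x) (f x.+1)).+1.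
Proof.
rewrite /is_break negb_and !negbK => /orP[]/eqP e.
  have -> : minn (f x) (f x.+1) = f x.+1 by lia.
  by rewrite -{2}e e !pfunK -e pfunK; lia.
have -> : minn (f x) (f x.+1) = f x by lia.
by rewrite -{2}e e !pfunK -e pfunK; lia.
Qed.

Lemma run_inv_const x y : x <= y -> run f x = run f y -> run g (f x) = run g (f y).
Proof.
apply: (run_const (h := fun x => run g (f x))) => z /is_break_inv[/negbTE nb e].
have : run g (maxn (f z) (f z.+1)) = run g (minn (f z) (f z.+1)).
  by rewrite e runS nb addn0.
by case: (leqP (f z) (f z.+1)).
Qed.

(** Inside a run of length at least 2, the direction of the run, read from whichever neighbour lies
in the run. *)
Definition ascending (x : nat) : bool :=
  (f x.+1 == (f x).+1) || (0 < x) && (f x == (f x.-1).+1).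

Lemma ascending_step x : ~~ is_break f x ->
  ascending x = ascending x.+1 /\ ascending x = (f x < f x.+1).
Proof.
have inj a b : f a = f b -> a = b by apply: pfun_inj.
have i1 := inj x.-1 x.+1; have i2 := inj x x.+2.
by rewrite /is_break /ascending /=; lia.
Qed.

Lemma ascending_const x y : x <= y -> run f x = run f y -> ascending x = ascending y.
Proof. by apply: run_const => z /ascending_step[]. Qed.

Lemma run_monotone x y : x < y -> run f x = run f y ->
  if ascending x then f x < f y else f y < f x.
Proof.
move/subnKC=> <-; elim: (y - x.+1) => [|d IH]; last first.
  rewrite addSn in IH; rewrite addSn addnS runS => e.
  have le := run_mono f (leqW (leq_addr d x)).
  have nb : ~~ is_break f (x + d).+1 by lia.
  have e' : run f x = run f (x + d).+1 by lia.
  have := IH e'; have [_] := ascending_step nb.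
  rewrite -(ascending_const _ e'); last by lia.
  by have := @pfun_inj _ p (x + d).+1 (x + d).+2; case: ascending; lia.
rewrite addn0 runS => e; have /ascending_step[_ ->] : ~~ is_break f x by lia.
by have := @pfun_inj _ p x x.+1; case: ltngtP => //; lia.
Qed.
End Runs.

Section Grid.
Variable K : nat.

(** The lexicographic rank of the triple [(a, b, s)]. *)
Definition code (a b : nat) (s : bool) : nat := (a * K + b).*2 + s.

Definition decode (x : nat) : nat * nat * bool := (x./2 %/ K, x./2 %% K, odd x).

Lemma codeK a b s : b < K -> decode (code a b s) = (a, b, s).
Proof.
move=> bK; rewrite /decode /code.
have -> : ((a * K + b).*2 + s)./2 = a * K + b by rewrite addnC half_bit_double.
have -> : odd ((a * K + b).*2 + s) = s by rewrite oddD odd_double; case: s.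
by rewrite divnMDl ?modnMDl ?divn_small ?modn_small ?addn0 //; lia.
Qed.

Lemma decode_inj : injective decode.
Proof.
move=> x y [e1 e2 e3]; rewrite -(odd_double_half x) -(odd_double_half y) e3.
by rewrite (divn_eq x./2 K) (divn_eq y./2 K) e1 e2.
Qed.

Lemma code_lt a b s : a < K -> b < K -> code a b s < (K * K).*2.
Proof. by rewrite /code; case: s; nia. Qed.

Lemma code_mono a b s a' b' s' : b < K -> b' < K -> a <= a' ->
  (a = a' -> b = b' /\ s = s') -> code a b s <= code a' b' s'.
Proof.
move=> bK b'K; rewrite leq_eqVlt => /orP[/eqP-> /(_ erefl)[-> ->] //|aa' _].
by rewrite /code; case: s; case: s'; nia.
Qed.

Definition transposed (c d : nat * nat * bool) : bool :=
  [&& c.1.1 == d.1.2, c.1.2 == d.1.1 & c.2 == d.2].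

(** Column [(a, b, s)] meets row [(b, a, s)]: the order on the rows exchanges the two ranks, so that
any arrangement of at most [K] runs can be spread over this single matching, leaving the other cells
empty. *)
Definition universal_matrix : 'M[int]_((K * K).*2, (K * K).*2) :=
  \matrix_(x, y) (if transposed (decode x) (decode y) then
                    if odd x then 1%R else (-1)%R else 0%R).

Lemma universal_matrix_signs : sign_matrix universal_matrix.
Proof. by move=> k l; rewrite mxE; case: ifP => _; first case: ifP. Qed.

Lemma universal_matrix_neq0 k l :
  universal_matrix k l != 0%R -> transposed (decode k) (decode l).
Proof. by rewrite mxE; case: ifP => //; rewrite eqxx. Qed.

Lemma universal_matrix_matching : is_matching (grid_graph universal_matrix).
Proof.
have tr c d d' : transposed c d -> transposed c d' -> d = d'.
  case: c d d' => [[? ?] ?] [[? ?] ?] [[? ?] ?] /and3P[/= /eqP-> /eqP-> /eqP->].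
  by case/and3P=> /= /eqP-> /eqP-> /eqP->.
have tr' c d d' : transposed d c -> transposed d' c -> d = d'.
  case: c d d' => [[? ?] ?] [[? ?] ?] [[? ?] ?] /and3P[/= /eqP-> /eqP-> /eqP->].
  by case/and3P=> /= /eqP-> /eqP-> /eqP->.
move=> v; apply/card_le1_eqP => w w'; rewrite !inE.
case: v w w' => [k|l] [k1|l1] [k2|l2] //= /universal_matrix_neq0 h1 /universal_matrix_neq0 h2.
  by congr inr; apply: ord_inj; apply: decode_inj; apply: tr h2 h1.
by congr inl; apply: ord_inj; apply: decode_inj; apply: tr' h2 h1.
Qed.

(** Codes of columns increase with the position because a run determines its rank by value and its
direction; dually for rows, since runs of the inverse are runs of the permutation. *)
Lemma in_Grid_universal n (p : 'S_n) :
  size (breaks (pfun p) n) < K -> size (breaks (pfun p^-1) n) < K ->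
  in_Grid universal_matrix p.
Proof.
set f := pfun p; set g := pfun p^-1 => bf bg.
pose a i := run f i; pose b i := run g (f i); pose s i := ascending p i.
have aK i : i < n -> a i < K by move=> /(run_le_breaks f); rewrite /a; lia.
have bK i : i < n -> b i < K.
  by move=> iN; have := run_le_breaks g (pfun_lt p iN); rewrite /b -/f; lia.
pose col i := code (a i) (b i) (s i).
pose row i := code (b i) (a i) (s i).
have col_mono i j : i <= j -> j < n -> col i <= col j.
  move=> ij jn; apply: code_mono; rewrite ?bK ?run_mono //; first exact: leq_ltn_trans jn.
  by move=> e; split; [apply: run_inv_const | apply: ascending_const].
have row_mono i j : i <= j -> j < n -> row (g i) <= row (g j).
  move=> ij jn; have in_ : i < n by lia.
  have bE k : b (g k) = run g k by rewrite /b /f /g pfunVK.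
  apply: code_mono; rewrite ?aK ?pfun_lt ?bE ?run_mono // => e.
  have ae : a (g i) = a (g j).
    by have := @run_inv_const _ p^-1 i j ij; rewrite invgK; apply.
  split=> //; rewrite /s.
  by case/orP: (leq_total (g i) (g j)) => le; [| apply/esym]; apply: ascending_const.
exists (fun k => cut n col k), (fun l => cut n (row \o g) l); split.
- by apply: divides_interval_cut => i iN; apply: code_lt; [apply: aK | apply: bK].
- apply: divides_interval_cut => i iN.
  by apply: code_lt; [apply: bK | apply: aK]; apply: pfun_lt.
move=> k l A.
have AE i : i \in A -> col i = k /\ row i = l.
  rewrite inE /lo /hi /= /bump !add1n !cut_interval //.
  by rewrite /= -pfun_ord /g pfunK => /andP[/eqP-> /eqP->].
have Arun i j : i \in A -> j \in A -> i < j ->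
    if odd k then p i < p j else p j < p i.
  move=> /AE[ci _] /AE[cj _] ij.
  have [e1 e2 e3] : decode k = (a i, b i, s i) by rewrite -ci codeK ?bK.
  have [e1' e2' e3'] : decode k = (a j, b j, s j) by rewrite -cj codeK ?bK.
  by rewrite e3 -!pfun_ord; apply: run_monotone => //; rewrite -/f -/(a i) -/(a j) -e1.
split; rewrite mxE.
- case: ifP => // _; case: ifP => // o _ i j iA jA ij.
  by have := Arun i j iA jA ij; rewrite o.
- case: ifP => // _; case: ifP => // o _ i j iA jA ij.
  by have := Arun i j iA jA ij; rewrite o.
case: ifP => [|/negP nt]; first by case: ifP.
move=> _; apply/setP=> i; rewrite [RHS]inE; apply/negP=> /AE[ci ri]; apply: nt.
by rewrite -ci -ri !codeK ?aK ?bK // /transposed !eqxx.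
Qed.
End Grid.

(** * Eventually polynomial sequences *)

Section EventuallyPolynomial.
Local Open Scope ring_scope.

Lemma eventually_polynomial_eq a b N :
  (forall n, (N <= n)%N -> a n = b n) -> eventually_polynomial a -> eventually_polynomial b.
Proof.
move=> ab [p [M pM]]; exists p, (maxn M N) => n nM.
by rewrite -ab ?pM //; lia.
Qed.

Lemma eventually_polynomial_const c : eventually_polynomial (fun=> c).
Proof. by exists (c%:R)%:P, 0 => n _; rewrite hornerC. Qed.

Lemma eventually_polynomialD a b : eventually_polynomial a -> eventually_polynomial b ->
  eventually_polynomial (fun n => a n + b n)%N.
Proof.
move=> [p [M pM]] [q [N qN]]; exists (p + q), (maxn M N) => n nMN.
by rewrite natrD hornerD pM ?qN //; lia.
Qed.

Lemma eventually_polynomial_sum (I : eqType) (r : seq I) (a : I -> nat -> nat) :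
  (forall i, i \in r -> eventually_polynomial (a i)) ->
  eventually_polynomial (fun n => \sum_(i <- r) a i n)%N.
Proof.
elim: r => [|i r IH] ar.
  apply: (@eventually_polynomial_eq (fun=> 0%N) _ 0); last exact: eventually_polynomial_const.
  by move=> n _; rewrite big_nil.
apply: (@eventually_polynomial_eq (fun n => a i n + \sum_(i <- r) a i n)%N _ 0).
  by move=> n _; rewrite big_cons.
apply: eventually_polynomialD; first by apply: ar; rewrite mem_head.
by apply: IH => j jr; apply: ar; rewrite inE jr orbT.
Qed.

Lemma eventually_polynomial_shift a k : eventually_polynomial a ->
  eventually_polynomial (fun n => a (n - k)%N).
Proof.
move=> [p [N pN]]; exists (p \Po ('X - k%:R%:P)), (N + k)%N => n nN.
by rewrite pN ?horner_comp ?hornerD ?hornerN ?hornerX ?hornerC ?natrB //; lia.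
Qed.

(** Induction on the degree: the difference of [c X^(e+1) / (e+1)] has leading term [c X^e]. *)
Lemma polynomial_antidifference (p : {poly rat}) :
  exists q : {poly rat}, forall x : rat, q.[x + 1] - q.[x] = p.[x].
Proof.
have [d] := ubnP (size p); elim: d p => // d IH p; rewrite ltnS => sp.
have [->|p0] := eqVneq p 0.
  by exists 0 => x; rewrite !horner0 subr0.
have sp0 : (0 < size p)%N by rewrite size_poly_gt0.
set e := (size p).-1; set c := lead_coef p.
pose s : {poly rat} := (c / e.+1%:R) *: 'X^(e.+1).
pose D := s \Po ('X + 1) - s.
have DE x : D.[x] = s.[x + 1] - s.[x].
  by rewrite hornerD hornerN horner_comp hornerD hornerX hornerC.
have [|q qE] := IH (p - D); last first.
  exists (q + s) => x; rewrite !hornerD.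
  have := qE x; rewrite hornerD hornerN DE => h.
  by rewrite -[p.[x]](subrK (s.[x + 1] - s.[x])) -h; ring.
have DS : D = (c / e.+1%:R) *: \sum_(i < e.+1) 'X^i *+ 'C(e.+1, i).
  rewrite /D /s comp_polyZ comp_Xn_poly -scalerBr; congr (_ *: _).
  rewrite ['X + 1]addrC exprDn big_ord_recr /= subnn expr0 mul1r binn mulr1n addrK.
  by apply: eq_bigr => i _; rewrite expr1n mul1r.
apply: leq_trans sp.
have -> : size p = e.+1 by rewrite prednK.
rewrite ltnS; apply/leq_sizeP => j ej.
have coefS k : (\sum_(i < e.+1) 'X^i *+ 'C(e.+1, i) : {poly rat})`_k
     = (if (k < e.+1)%N then 'C(e.+1, k)%:R else 0).
  rewrite coef_sum.
  under eq_bigr => i _ do rewrite coefMn coefXn.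
  case: ifP => ke.
    rewrite (bigD1 (Ordinal ke)) //= eqxx big1 ?addr0 // => i ine.
    rewrite (_ : (k == i) = false) ?mul0rn //; apply/negbTE; apply: contra ine => /eqP ki.
    by apply/eqP/val_inj.
  by rewrite big1 // => i _; rewrite (_ : (k == i) = false) ?mul0rn //; have := ltn_ord i; lia.
rewrite coefB DS coefZ coefS.
move: ej; rewrite leq_eqVlt => /orP[/eqP<-|ej]; last first.
  rewrite ifF ?mulr0 ?subr0; last by lia.
  by apply: nth_default; rewrite -(prednK sp0).
rewrite ltnSn binSn -mulrA mulVf ?mulr1 ?pnatr_eq0 //.
by rewrite /c lead_coefE subrr.
Qed.

Lemma eventually_polynomial_partial_sum a : eventually_polynomial a ->
  eventually_polynomial (fun n => \sum_(i < n.+1) a i)%N.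
Proof.
move=> aP; have [p [N pN]] := aP; have [q qE] := polynomial_antidifference p.
apply: (@eventually_polynomial_eq (fun n => \sum_(i < n) a i + a n)%N _ 0).
  by move=> n _; rewrite big_ord_recr.
apply: eventually_polynomialD => //.
exists (q + (((\sum_(i < N) a i)%N)%:R - q.[N%:R])%:P), N => n /subnKC <-.
rewrite hornerD hornerC; elim: (n - N)%N => [|d IH]; first by rewrite addn0; ring.
by rewrite addnS big_ord_recr natrD /= IH pN ?leq_addr // -qE -natr1; ring.
Qed.
End EventuallyPolynomial.

(** * Hilbert functions of downsets *)

(** The one-step form of closure under the product order, which is what deleting points provides. *)
Definition downset (m : nat) (D : seq nat -> bool) : Prop :=
  forall u a v, size u + (size v).+1 = m -> D (u ++ a.+1 :: v) -> D (u ++ a :: v).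

Fixpoint compositions (m n : nat) : seq (seq nat) :=
  if m is m'.+1 then [seq a :: l | a <- iota 0 n.+1, l <- compositions m' (n - a)]
  else if n == 0 then [:: [::]] else [::].

Lemma compositionsS m n :
  compositions m.+1 n = [seq a :: l | a <- iota 0 n.+1, l <- compositions m (n - a)].
Proof. by []. Qed.

Lemma mem_compositions m n (l : seq nat) :
  (l \in compositions m n) = (size l == m) && (sumn l == n).
Proof.
elim: m n l => [|m IH] n l.
  by case: n => [|n]; case: l => [|x l].
rewrite compositionsS; apply/allpairsPdep/idP => [[a [l' [+ + ->]]]|].
  by rewrite mem_iota IH add0n /= => ? /andP[/eqP-> /eqP->]; rewrite eqxx; lia.
case: l => [|a l] //= /andP[sl sn]; exists a, l; split=> //.
  by rewrite -[0 :: _]/(iota 0 n.+1) mem_iota; lia.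
by move: sl sn; rewrite IH eqSS => /eqP-> /eqP<-; rewrite eqxx addKn eqxx.
Qed.

Lemma uniq_compositions m n : uniq (compositions m n).
Proof.
elim: m n => [|m IH] n; first by case: n.
by rewrite compositionsS; apply: allpairs_uniq_dep => [||[a l] [a' l'] _ _ /= [-> ->] //];
  rewrite ?iota_uniq.
Qed.

Lemma downset_cons m D a : downset m.+1 D -> downset m (fun l => D (a :: l)).
Proof. by move=> dD u b v s; apply: (dD (a :: u)) => /=; rewrite -s addSn. Qed.

Lemma downset_head m D a l : downset m.+1 D -> size l = m -> D (a.+1 :: l) -> D (a :: l).
Proof. by move=> dD s; apply: (dD [::]); rewrite /= s. Qed.

Lemma decreasing_trans (D : nat -> bool) i j :
  (forall k, D k.+1 -> D k) -> i <= j -> D j -> D i.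
Proof.
by move=> dec /subnKC <-; elim: (j - i) => [|d IH]; rewrite ?addn0 // addnS => /dec.
Qed.

(** Dickson's lemma for descending chains. Slicing by the first entry gives a family that decreases
both in [k] and in the entry; by induction its diagonal stabilises, which freezes all slices beyond
some [K0], and the finitely many slices before [K0] stabilise one by one. *)
Lemma downset_chain_stabilizes m (D : nat -> seq nat -> bool) :
  (forall k, downset m (D k)) ->
  (forall k l, size l = m -> D k.+1 l -> D k l) ->
  exists K, forall k l, K <= k -> size l = m -> D k l = D K l.
Proof.
elim: m D => [|m IH] D dD dec.
  have [all|nall] := classic (forall k, D k [::]).
    by exists 0 => k l _ /size0nil ->; rewrite !all.
  have [K DK] := not_all_ex_not _ _ nall.
  exists K => k l Kk /size0nil ->.
  rewrite (negbTE (introN idP DK)); apply/negP => h; apply: DK.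
  by apply: (@decreasing_trans (fun k => D k [::]) _ k) => // i; apply: dec.
have decl k k' a a' l : size l = m -> k <= k' -> a <= a' -> D k' (a' :: l) -> D k (a :: l).
  move=> sl kk' aa' h; apply: (@decreasing_trans (fun a => D k (a :: l)) _ a') => //.
    by move=> b; apply: downset_head (dD k) sl.
  by apply: (@decreasing_trans (fun k => D k (a' :: l)) _ k') => // b; apply: dec; rewrite /= sl.
(* the diagonal controls the slices a >= K0 of D k for k >= K0; finitely many slices remain *)
have [K0 K0P] : exists K0, forall k l, K0 <= k -> size l = m -> D k (k :: l) = D K0 (K0 :: l).
  apply: (IH (fun k l => D k (k :: l))) => k; first exact: downset_cons.
  by move=> l sl; apply: decl.
have [K1 K1P] : exists K1, forall a k l, a < K0 -> K1 <= k -> size l = m ->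
    D k (a :: l) = D K1 (a :: l).
  elim: (K0) => [|b [K1 K1P]]; first by exists 0.
  have [|k l sl|K2 K2P] := IH (fun k l => D k (b :: l)).
  - by move=> k; apply: downset_cons.
  - by apply: dec; rewrite /= sl.
  exists (maxn K1 K2) => a k l; rewrite ltnS leq_eqVlt => /orP[/eqP->|ab] Kk sl.
    by rewrite (K2P k) ?(K2P (maxn K1 K2)) //; lia.
  by rewrite (K1P a k) ?(K1P a (maxn K1 K2)) //; lia.
exists (maxn K0 K1) => k [|a l] // Kk [sl].
case: (ltnP a K0) => aK; first by rewrite (K1P a k) ?(K1P a (maxn K0 K1)) //; lia.
have same k' : K0 <= k' -> D k' (a :: l) = D K0 (K0 :: l).
  move=> K0k'; apply/idP/idP; first exact: decl.
  rewrite -(K0P (maxn a k')) //; last by lia.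
  by apply: decl => //; lia.
by rewrite !same //; lia.
Qed.

Lemma count_compositionsS m n (D : pred (seq nat)) :
  count D (compositions m.+1 n) =
  \sum_(0 <= a < n.+1) count (fun l => D (a :: l)) (compositions m (n - a)).
Proof.
rewrite compositionsS count_flatten -map_comp sumnE big_map.
by rewrite /index_iota subn0; apply: eq_bigr => a _; rewrite /= count_map.
Qed.

(** The slices by the first entry decrease, hence are equal from some [A] on. The first [A] slices
contribute shifted copies of their own counts, and the others a partial sum of one count. *)
Lemma downset_hilbert m (D : seq nat -> bool) : downset m D ->
  eventually_polynomial (fun n => count D (compositions m n)).
Proof.
elim: m D => [|m IH] D dD.
  apply: (@eventually_polynomial_eq (fun=> 0) _ 1); first by case.
  exact: eventually_polynomial_const.
have [A AP] : exists A, forall a l, A <= a -> size l = m -> D (a :: l) = D (A :: l).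
  apply: (@downset_chain_stabilizes m (fun a l => D (a :: l))) => a; first exact: downset_cons.
  by move=> l; apply: downset_head.
pose h a n := count (fun l => D (a :: l)) (compositions m n).
have hP a : eventually_polynomial (h a) by apply: IH; apply: downset_cons.
apply: (@eventually_polynomial_eq (fun n => \sum_(a <- iota 0 A) h a (n - a) +
    \sum_(i < (n - A).+1) h A i) _ A).
  move=> n An; rewrite count_compositionsS.
  rewrite (big_cat_nat (n := A)) //=; last by lia.
  congr (_ + _); first by rewrite /index_iota subn0.
  rewrite -[X in \sum_(X <= _ < _) _]add0n big_addn subSn //.
  rewrite -(big_mkord xpredT (h A)) [RHS]big_nat_rev /=.
  rewrite !big_nat; apply: eq_bigr => i /andP[_ ilt].
  have -> : n - (0 + (n - A).+1 - i.+1 + A) = i by lia.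
  apply: eq_in_count => l; rewrite mem_compositions => /andP[/eqP sl _].
  by rewrite [RHS]AP //; lia.
apply: eventually_polynomialD.
  by apply: eventually_polynomial_sum => a _; apply: eventually_polynomial_shift.
exact: (eventually_polynomial_shift A (eventually_polynomial_partial_sum (hP A))).
Qed.

(** * Ends of runs and the gaps between them *)

(** The interior points of runs. The other points are the ends of runs, runs of length 1 being their
own end. *)
Definition mid (f : nat -> nat) (n x : nat) : bool :=
  [&& 0 < x, x.+1 < n &
    (f x == (f x.-1).+1) && (f x.+1 == (f x).+1) ||
    (f x.-1 == (f x).+1) && (f x == (f x.+1).+1)].

Definition mask (f : nat -> nat) (n : nat) : bitseq := [seq mid f n x | x <- iota 0 n].

Definition ends (f : nat -> nat) (n : nat) : seq nat := [seq x <- iota 0 n | ~~ mid f n x].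

(** The standardisation of the sequence [f] without its entry at [i]. *)
Definition delete_at (f : nat -> nat) (i x : nat) : nat := unbump (f i) (f (bump i x)).

Lemma eq_mid f f' n : f =1 f' -> mid f n =1 mid f' n.
Proof. by move=> e x; rewrite /mid !e. Qed.

Lemma nth_mask f n x : nth false (mask f n) x = mid f n x.
Proof.
case: (ltnP x n) => xn; first by rewrite (nth_map 0) ?size_iota // nth_iota.
by rewrite nth_default ?size_map ?size_iota // /mid; lia.
Qed.

Lemma size_mask f n : size (mask f n) = n.
Proof. by rewrite size_map size_iota. Qed.

Lemma mem_ends f n x : (x \in ends f n) = (x < n) && ~~ mid f n x.
Proof. by rewrite mem_filter mem_iota /= add0n andbC. Qed.

Lemma size_ends f n : size (ends f n) = count negb (mask f n).
Proof. by rewrite size_filter count_map. Qed.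

(** An end of a run is the first or last position or is adjacent to a break. *)
Lemma size_ends_breaks n (p : 'S_n) :
  size (ends (pfun p) n) <= (size (breaks (pfun p) n)).*2.+2.
Proof.
set f := pfun p; set b := breaks f n.
apply: (@leq_trans (size (0 :: n.-1 :: b ++ [seq x.+1 | x <- b]))); last first.
  by rewrite /= size_cat size_map addnn.
apply: uniq_leq_size => [|x]; first by rewrite filter_uniq ?iota_uniq.
rewrite mem_ends !inE mem_cat !mem_filter !mem_iota /= add0n => /andP[xn].
have [->//|x0] := posnP x; have [->//|xn1] := eqVneq x n.-1.
have -> : x < n.-1 by lia.
rewrite andbT; case xb: (is_break f x); first by rewrite orbT.
move=> nm; suff : x \in [seq x.+1 | x <- b] by move=> ->; rewrite !orbT.
apply/mapP; exists x.-1; last by rewrite prednK.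
rewrite mem_filter mem_iota /= add0n; apply/andP; split; last by lia.
have i1 : f x.-1 = f x.+1 -> x.-1 = x.+1 by apply: pfun_inj.
by move: nm xb; rewrite /mid /is_break prednK //; lia.
Qed.

Section Deletion.
Variables (n : nat) (p : 'S_n.+1) (i : nat).
Notation f := (pfun p).

Let fi a b : f a = f b -> a = b. Proof. exact: pfun_inj. Qed.

Lemma bump_neq x : bump i x <> i.
Proof. by rewrite /bump; lia. Qed.

Lemma bump_delete_at x : bump (f i) (delete_at f i x) = f (bump i x).
Proof. by rewrite /delete_at unbumpK //= inE; apply/eqP => /fi/bump_neq. Qed.

Lemma delete_at_lt x y : (delete_at f i x < delete_at f i y) = (f (bump i x) < f (bump i y)).
Proof. by rewrite -!bump_delete_at /bump; lia. Qed.

Hypothesis mid_i : mid f n.+1 i.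

Lemma exists_delete_at : exists q : 'S_n, pfun q =1 delete_at f i.
Proof.
have iN : i < n.+1 by move: mid_i; rewrite /mid; lia.
have fN := pfun_lt p iN.
have [|x y xn yn e|q qE] := @perm_of_fun n (delete_at f i).
- move=> x xn; have : f (bump i x) < n.+1 by apply: pfun_lt; rewrite /bump; lia.
  by rewrite -bump_delete_at /bump; lia.
- have := fi (etrans (esym (bump_delete_at x)) (etrans (congr1 _ e) (bump_delete_at y))).
  by rewrite /bump; lia.
exists q => x; case: (ltnP x n) => xn; first exact: qE.
rewrite pfun_ge // /delete_at [bump i x](_ : _ = x.+1); last by rewrite /bump; lia.
by rewrite (@pfun_ge _ p x.+1) /unbump; lia.
Qed.

Lemma delete_at_in_class (C : forall n, {set 'S_n}) (q : 'S_n) :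
  perm_class C -> p \in C n.+1 -> pfun q =1 delete_at f i -> q \in C n.
Proof.
have iN : i < n.+1 by move: mid_i; rewrite /mid; lia.
move=> hC pC qE; apply: hC pC _; exists (lift (Ordinal iN)) => [j k jk|j k].
  by rewrite /= /bump; lia.
by rewrite -!pfun_ord /= !qE delete_at_lt.
Qed.

(** Deleting [f i] creates a new pair of consecutive values only out of [f i - 1] and [f i + 1],
which are the values at [i - 1] and [i + 1]. *)
Lemma delete_at_consecutive x y :
  bump i x != (bump i y).+2 -> bump i y != (bump i x).+2 ->
  (delete_at f i y == (delete_at f i x).+1) = (f (bump i y) == (f (bump i x)).+1).
Proof.
move=> xy yx; have ex := bump_delete_at x; have ey := bump_delete_at y.
apply/eqP/eqP => e; last by move: e ex ey; rewrite /bump; lia.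
have [//|ne] := eqVneq (f (bump i y)) (f (bump i x)).+1.
have [vx vy] : (f (bump i x)).+1 = f i /\ f (bump i y) = (f i).+1.
  by move: ex ey ne; rewrite /bump; lia.
have jx := @fi (bump i x) i.-1; have jx' := @fi (bump i x) i.+1.
have jy := @fi (bump i y) i.-1; have jy' := @fi (bump i y) i.+1.
by move: mid_i xy yx; rewrite /mid; lia.
Qed.

Lemma consecutive_around_mid :
  [/\ (f i == (f i.-1).+1) = (delete_at f i i == (delete_at f i i.-1).+1),
      (f i.+1 == (f i).+1) = (delete_at f i i == (delete_at f i i.-1).+1),
      (f i.-1 == (f i).+1) = (delete_at f i i.-1 == (delete_at f i i).+1) &
      (f i == (f i.+1).+1) = (delete_at f i i.-1 == (delete_at f i i).+1)].
Proof.
have e1 := bump_delete_at i.-1; have e2 := bump_delete_at i; move: mid_i e1 e2; rewrite /mid.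
have -> : bump i i = i.+1 by rewrite /bump; lia.
have [->|i0] := posnP i; first by [].
have -> : bump i i.-1 = i.-1 by rewrite /bump; lia.
by rewrite /bump => *; split; lia.
Qed.

Lemma mid_delete_at x : x < n -> mid (delete_at f i) n x = mid f n.+1 (bump i x).
Proof.
move=> xn; have iN : 0 < i < n by move: mid_i; rewrite /mid; lia.
rewrite /mid; have [->|x0] := posnP x; first by have -> : bump i 0 = 0 by rewrite /bump; lia.
have -> : ((bump i x).+1 < n.+1) = (x.+1 < n) by rewrite /bump; lia.
have -> : 0 < bump i x by rewrite /bump; lia.
congr [&& _, _ & _].
have bl y : y < i -> bump i y = y by rewrite /bump; lia.
have br y : i <= y -> bump i y = y.+1 by rewrite /bump; lia.
have [c1 c2 c3 c4] := consecutive_around_mid.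
have dxp := @delete_at_consecutive x.-1 x; have dpx := @delete_at_consecutive x x.-1.
have dxs := @delete_at_consecutive x x.+1; have dsx := @delete_at_consecutive x.+1 x.
have [xi|ix] := ltnP x i.
  have bxp := bl x.-1 (leq_ltn_trans (leq_pred x) xi).
  rewrite (bl x xi) bxp in dxp dpx dxs dsx *; rewrite {}dxp ?{}dpx; try by clear -x0; lia.
  have [ei|ni] := eqVneq x.+1 i; first by rewrite -ei /= in c1 c3; rewrite -ei c1 c3.
  have bxn : bump i x.+1 = x.+1 by apply: bl; rewrite ltn_neqAle ni.
  by rewrite bxn in dxs dsx; rewrite {}dxs ?{}dsx //; clear; lia.
rewrite (br x ix) (br x.+1 (leqW ix)) /= in dxp dpx dxs dsx *.
rewrite {}dxs ?{}dsx; try by clear; lia.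
have [ei|ni] := eqVneq x i; first by rewrite ei c2 c4.
have bxp : bump i x.-1 = x by rewrite br ?prednK // -ltnS prednK // ltn_neqAle eq_sym ni.
by rewrite bxp in dxp dpx; rewrite {}dxp ?{}dpx //; clear; lia.
Qed.

Lemma mask_delete_at u v :
  mask f n.+1 = u ++ true :: v -> size u = i -> mask (delete_at f i) n = u ++ v.
Proof.
move=> e su; have sz : size (u ++ true :: v) = n.+1 by rewrite -e size_mask.
have sz' : size (u ++ v) = n by move: sz; rewrite !size_cat /=; lia.
apply: (@eq_from_nth _ false) => [|x]; first by rewrite size_mask.
rewrite size_mask => xn; rewrite nth_mask mid_delete_at // -nth_mask e !nth_cat /bump su.
case: (ltnP x i) => xi; first by rewrite add0n xi.
by rewrite add1n ifF ?subSn //; lia.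
Qed.

Lemma ends_delete_at : ends f n.+1 = [seq bump i x | x <- ends (delete_at f i) n].
Proof.
have iN : i < n.+1 by move: mid_i; rewrite /mid; lia.
apply: (irr_sorted_eq ltn_trans ltnn).
- by apply: sorted_filter (iota_ltn_sorted _ _); apply: ltn_trans.
- rewrite sorted_map; apply: (sub_sorted (e := ltn)) => [x y|].
    by rewrite /= /bump; lia.
  by apply: sorted_filter (iota_ltn_sorted _ _); apply: ltn_trans.
move=> x; rewrite mem_ends; apply/andP/mapP => [[xn nm]|[y + ->]].
  have xi : x != i by apply: contraNneq nm => ->.
  have xE : bump i (unbump i x) = x by rewrite unbumpK.
  exists (unbump i x) => //; rewrite mem_ends.
  have ln : unbump i x < n by rewrite /unbump; lia.
  by rewrite ln mid_delete_at // xE.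
rewrite mem_ends => /andP[yn]; rewrite mid_delete_at // => ->; split=> //.
by rewrite /bump; lia.
Qed.

(** The value in the middle of three consecutive values becomes the larger of the two that remain.
*)
Lemma mid_value_from_delete_at : f i = maxn (delete_at f i i.-1) (delete_at f i i).
Proof.
have e1 := bump_delete_at i.-1; have e2 := bump_delete_at i; move: mid_i e1 e2; rewrite /mid.
have -> : bump i i = i.+1 by rewrite /bump; lia.
have [->|i0] := posnP i; first by [].
have -> : bump i i.-1 = i.-1 by rewrite /bump; lia.
by rewrite /bump; lia.
Qed.
End Deletion.

Lemma count_lt_iota k n : k <= n -> count (fun v => v < k) (iota 0 n) = k.
Proof.
move=> kn; rewrite -(subnKC kn) iotaD count_cat [X in _ + X](_ : _ = 0).
  rewrite addn0 -[RHS](size_iota 0 k); apply/eqP; rewrite -all_count.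
  by apply/allP=> v; rewrite mem_iota.
by apply/eqP; rewrite -leqn0 leqNgt -has_count; apply/hasPn=> v; rewrite mem_iota; lia.
Qed.

Lemma pfun_rank n (p : 'S_n) x : x < n ->
  count (fun y => pfun p y < pfun p x) (iota 0 n) = pfun p x.
Proof.
move=> xn; rewrite -[RHS](@count_lt_iota _ n); last exact/ltnW/pfun_lt.
rewrite -(count_map (pfun p) (fun v => v < pfun p x)).
apply/seq.permP/uniq_perm; rewrite ?map_inj_uniq ?iota_uniq //; first exact: pfun_inj.
move=> v; rewrite mem_iota add0n /=; apply/mapP/idP => [[y + ->]|vn].
  by rewrite mem_iota add0n => /pfun_lt.
by exists (pfun p^-1 v); rewrite ?pfunVK // mem_iota add0n pfun_lt.
Qed.

Lemma perm_eq_order n (p q : 'S_n) :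
  (forall x y, x < n -> y < n -> (pfun p x < pfun p y) = (pfun q x < pfun q y)) -> p = q.
Proof.
move=> e; apply: eq_pfun => x; case: (ltnP x n) => xn; last by rewrite !pfun_ge.
rewrite -(pfun_rank p xn) -(pfun_rank q xn); apply: eq_in_count => y.
by rewrite mem_iota add0n => yn; apply: e.
Qed.

(** Induction on the length, deleting a point that is interior in both permutations and reinserting
it. *)
Lemma perm_eq_ends n (p q : 'S_n) :
  mask (pfun p) n = mask (pfun q) n ->
  {in ends (pfun p) n &, forall x y, (pfun p x < pfun p y) = (pfun q x < pfun q y)} ->
  p = q.
Proof.
elim: n p q => [|n IH] p q em ee; first by apply: perm_eq_order.
have mE x : mid (pfun p) n.+1 x = mid (pfun q) n.+1 x by rewrite -!nth_mask em.
have [/hasP[i _ mi]|/hasPn nomid] := boolP (has (mid (pfun p) n.+1) (iota 0 n.+1)); last first.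
  apply: perm_eq_order => x y xn yn; apply: ee; rewrite mem_ends ?xn ?yn /=;
  by apply: nomid; rewrite mem_iota.
have mi' : mid (pfun q) n.+1 i by rewrite -mE.
have [p' p'E] := exists_delete_at mi; have [q' q'E] := exists_delete_at mi'.
have pq' : p' = q'.
  have mp' x : x < n -> mid (pfun p') n x = mid (pfun p) n.+1 (bump i x).
    by move=> xn; rewrite (eq_mid _ p'E) mid_delete_at.
  have mq' x : x < n -> mid (pfun q') n x = mid (pfun q) n.+1 (bump i x).
    by move=> xn; rewrite (eq_mid _ q'E) mid_delete_at.
  apply: IH => [|x y].
    by apply/eq_in_map => x; rewrite mem_iota add0n => xn; rewrite mp' // mq'.
  rewrite !mem_ends => /andP[xn nx] /andP[yn ny]; rewrite !p'E !q'E !delete_at_lt.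
  by apply: ee; rewrite mem_ends -mp' // ?nx ?ny andbT /bump; lia.
have dE x : delete_at (pfun p) i x = delete_at (pfun q) i x by rewrite -p'E -q'E pq'.
have iE : pfun p i = pfun q i.
  by rewrite (mid_value_from_delete_at mi) (mid_value_from_delete_at mi') !dE.
apply: eq_pfun => x; have [->//|xi] := eqVneq x i.
have <- : bump i (unbump i x) = x by rewrite unbumpK.
by rewrite -!bump_delete_at dE iE.
Qed.

(** The numbers of [true]s before each [false], the first one being increased by [k]. *)
Fixpoint gaps (k : nat) (w : bitseq) : seq nat :=
  match w with
  | [::] => [::]
  | true :: w' => gaps k.+1 w'
  | false :: w' => k :: gaps 0 w'
  end.

Definition mask_of_gaps (l : seq nat) : bitseq :=
  flatten [seq rcons (nseq a true) false | a <- l].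

Lemma gapsK k w : last (0 < k) w = false -> mask_of_gaps (gaps k w) = nseq k true ++ w.
Proof.
elim: w k => [|[] w IH] k /=; first by case: k.
  by move=> e; rewrite (IH k.+1 e) -[k.+1]addn1 nseqD -catA.
by rewrite /mask_of_gaps /= -/(mask_of_gaps _) => e; rewrite (IH 0 e) cat_rcons.
Qed.

Lemma gaps_nseq k a w : gaps k (nseq a true ++ w) = gaps (a + k) w.
Proof. by elim: a k => //= a IH k; rewrite IH addnS. Qed.

Lemma mask_of_gapsK l : gaps 0 (mask_of_gaps l) = l.
Proof.
elim: l => //= a l IH.
by rewrite /mask_of_gaps /= -/(mask_of_gaps _) cat_rcons gaps_nseq addn0 /= IH.
Qed.

Lemma mask_of_gaps_cat l l' : mask_of_gaps (l ++ l') = mask_of_gaps l ++ mask_of_gaps l'.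
Proof. by rewrite /mask_of_gaps map_cat flatten_cat. Qed.

Lemma size_mask_of_gaps l : size (mask_of_gaps l) = sumn l + size l.
Proof.
elim: l => //= a l IH.
by rewrite /mask_of_gaps /= -/(mask_of_gaps _) size_cat size_rcons size_nseq IH; lia.
Qed.

Lemma size_gaps k w : size (gaps k w) = count negb w.
Proof. by elim: w k => [|[] w IH] k //=; rewrite IH. Qed.

Definition perm_gaps n (p : 'S_n) : seq nat := gaps 0 (mask (pfun p) n).

Lemma perm_gapsK n (p : 'S_n) : mask_of_gaps (perm_gaps p) = mask (pfun p) n.
Proof.
rewrite /perm_gaps gapsK //; case: n p => // n p.
rewrite (last_nth false) size_mask /= -[nth _ _ _]/(nth false (mask (pfun p) n.+1) n).
by rewrite nth_mask /mid ltnn andbF.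
Qed.

Lemma size_perm_gaps n (p : 'S_n) : size (perm_gaps p) = size (ends (pfun p) n).
Proof. by rewrite size_gaps size_ends. Qed.

Lemma sumn_perm_gaps n (p : 'S_n) : sumn (perm_gaps p) + size (perm_gaps p) = n.
Proof. by rewrite -size_mask_of_gaps perm_gapsK size_mask. Qed.

Section EndTypes.
Variable M : nat.
Definition end_type : finType := ('I_M.+1 * {ffun 'I_M * 'I_M -> bool})%type.

(** The relative order of the ends, as an element of a finite type. The number [M] bounds the number
of ends of the permutations to be counted. *)
Definition type_of (f : nat -> nat) (n : nat) : end_type :=
  let e := ends f n in
  (inord (size e), [ffun ab : 'I_M * 'I_M =>
     [&& ab.1 < size e, ab.2 < size e & f (nth 0 e ab.1) < f (nth 0 e ab.2)]]).

Lemma eq_type_of f f' n : f =1 f' -> type_of f n = type_of f' n.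
Proof.
move=> e; have eE : ends f n = ends f' n by apply: eq_filter => x; rewrite (eq_mid _ e).
rewrite /type_of eE; by congr (_, _); apply/ffunP=> ab; rewrite !ffunE !e.
Qed.

Lemma type_of_delete_at n (p : 'S_n.+1) i :
  mid (pfun p) n.+1 i -> type_of (delete_at (pfun p) i) n = type_of (pfun p) n.+1.
Proof.
move=> mi; rewrite /type_of (ends_delete_at mi) size_map; congr (_, _).
apply/ffunP=> -[a b]; rewrite !ffunE /=.
case al: (a < _) => //=; case bl: (b < _) => //=.
by rewrite !(nth_map 0) // delete_at_lt.
Qed.

(** Two run ends and the gap between them determine the points in between, so that permutations are
classified by a finite type and a vector of gaps. *)
Lemma eq_perm_type n (p q : 'S_n) :
  size (ends (pfun p) n) <= M ->
  perm_gaps p = perm_gaps q -> type_of (pfun p) n = type_of (pfun q) n -> p = q.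
Proof.
move=> sM eg et.
have em : mask (pfun p) n = mask (pfun q) n by rewrite -!perm_gapsK eg.
have ee : ends (pfun p) n = ends (pfun q) n.
  by apply: eq_filter => x; rewrite -!nth_mask em.
apply: perm_eq_ends em _ => x y xe ye.
have xi : index x (ends (pfun p) n) < size (ends (pfun p) n) by rewrite index_mem.
have yi : index y (ends (pfun p) n) < size (ends (pfun p) n) by rewrite index_mem.
have /ffunP/(_ (Ordinal (leq_trans xi sM), Ordinal (leq_trans yi sM))) := congr1 snd et.
by rewrite !ffunE /= -!ee xi yi /= !nth_index.
Qed.

Variable C : forall n, {set 'S_n}.
Hypothesis hC : perm_class C.

Definition gap_set (t : end_type) (l : seq nat) : bool :=
  let n := sumn l + size l in
  [exists p : 'S_n, [&& p \in C n, type_of (pfun p) n == t & perm_gaps p == l]].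

Lemma gap_setP t l : reflect
  (exists n (p : 'S_n), [/\ p \in C n, type_of (pfun p) n = t & perm_gaps p = l]) (gap_set t l).
Proof.
apply: (iffP existsP) => [[p /and3P[pC /eqP pt /eqP pl]]|[n [p [pC pt pl]]]].
  by exists (sumn l + size l), p.
have e : n = sumn l + size l by rewrite -pl sumn_perm_gaps.
by subst n; exists p; rewrite pC pt pl !eqxx.
Qed.

(** Deleting an interior point between two ends decreases the corresponding gap by one. *)
Lemma downset_gap_set m t : downset m (gap_set t).
Proof.
move=> u a v _ /gap_setP[n [p [pC pt pl]]]; apply/gap_setP.
have maskE : mask (pfun p) n = mask_of_gaps u ++ true :: (nseq a true ++ false :: mask_of_gaps v).
  by rewrite -perm_gapsK pl mask_of_gaps_cat /mask_of_gaps /= -/(mask_of_gaps _) cat_rcons.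
case: n p pC pt pl maskE => [|n] p pC pt pl maskE.
  by move: (congr1 size maskE); rewrite size_mask size_cat /=; lia.
pose i := size (mask_of_gaps u).
have mi : mid (pfun p) n.+1 i by rewrite -nth_mask maskE nth_cat ltnn subnn.
have [q qE] := exists_delete_at mi.
exists n, q; split; first exact: (delete_at_in_class mi hC pC qE).
  by rewrite (eq_type_of _ qE) type_of_delete_at.
rewrite /perm_gaps [mask _ _](_ : _ = mask_of_gaps (u ++ a :: v)) ?mask_of_gapsK //.
rewrite mask_of_gaps_cat /mask_of_gaps /= -/(mask_of_gaps _) cat_rcons.
by rewrite -(mask_delete_at mi maskE) //; apply: eq_map => x; apply: eq_mid.
Qed.

Hypothesis few_ends : forall n (p : 'S_n), p \in C n -> size (ends (pfun p) n) <= M.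

Lemma card_type (t : end_type) n : t.1 <= n ->
  #|[set p in C n | type_of (pfun p) n == t]| =
  count (gap_set t) (compositions t.1 (n - t.1)).
Proof.
move=> tn; rewrite cardE -(size_map (@perm_gaps n)) -size_filter.
apply/perm_size/uniq_perm.
- rewrite map_inj_in_uniq ?enum_uniq // => p q; rewrite !mem_enum !inE.
  move=> /andP[pC /eqP pt] /andP[qC /eqP qt] e.
  by apply: eq_perm_type e _; [apply: few_ends | rewrite pt qt].
- by rewrite filter_uniq ?uniq_compositions.
move=> l; rewrite mem_filter mem_compositions; apply/mapP/andP => [[p]|].
  rewrite mem_enum inE => /andP[pC /eqP pt] ->; split.
    by apply/gap_setP; exists n, p.
  have sm : size (perm_gaps p) = t.1.
    by rewrite size_perm_gaps -pt /= inordK // ltnS few_ends.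
  by rewrite sm eqxx /= -{2}(sumn_perm_gaps p) sm addnK.
case=> /gap_setP[k [p [pC pt pl]]] /andP[/eqP sl /eqP ll].
have e : k = n by rewrite -(sumn_perm_gaps p) pl sl ll subnK.
by subst k; exists p; rewrite // mem_enum inE pC pt eqxx.
Qed.

(** For a given type [t] with [t.1] ends, counting members of [C] is counting vectors of gaps of
weight [n - t.1] in a downset. *)
Lemma eventually_polynomial_of_few_ends : eventually_polynomial (fun n => #|C n|).
Proof.
apply: (@eventually_polynomial_eq (fun n => \sum_(t <- index_enum end_type)
    count (gap_set t) (compositions t.1 (n - t.1))) _ M).
  move=> n nM; rewrite -sum1_card (partition_big (fun p : 'S_n => type_of (pfun p) n) xpredT) //=.
  apply: eq_bigr => t _; rewrite -card_type; last exact: leq_trans (leq_ord _) nM.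
  by rewrite -sum1_card; apply: eq_bigl => p; rewrite inE.
apply: eventually_polynomial_sum => t _.
apply: (@eventually_polynomial_shift (fun k => count (gap_set t) (compositions t.1 k))).
exact/downset_hilbert/downset_gap_set.
Qed.
End EndTypes.

Theorem corollary3p4 (C : forall n : nat, {set 'S_n}) (hC : perm_class C) :
  (forall n : nat, 1 <= n -> fib n <= #|C n|) \/
  (in_grid_class_of_matching C /\ eventually_polynomial (fun n => #|C n|)).
Proof.
have [|nall] := classic (forall n, 1 <= n -> fib n <= #|C n|); [by left | right].
have [n0 [n00 few]] : exists n0, 0 < n0 /\ #|C n0| < fib n0.
  have [n0 h] := not_all_ex_not _ _ nall; have [h1 h2] := imply_to_and _ _ h.
  by exists n0; split=> //; rewrite ltnNge; apply/negP.
have [K KP] := few_breaks n00 hC few; split.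
  exists (K * K).*2, (K * K).*2, (universal_matrix K); split.
  - exact: universal_matrix_signs.
  - exact: universal_matrix_matching.
  by move=> n p /KP[]; apply: in_Grid_universal.
apply: (@eventually_polynomial_of_few_ends K.*2.+2) => // n p /KP[bK _].
by have := size_ends_breaks p; lia.
Qed.
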